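(* Fix an integer $t\ge 0$, an integer $d\ge2$ and a real $\mu\ge1$. Any graph $G$ with $N$ nodes, maximum node degree $\Delta$ and treewidth at most $t$ can be embedded into any $d$-dimensional grid with at least $N$ nodes and aspect ratio at most $\mu$, with an edge-congestion of $O(\Delta)$. Here the constant implied by $O(\cdot)$ depends only on $t$, $d$ and $\mu$ (not on $G$, $N$, $\Delta$ or the grid).
   Context: Guest graphs are finite, simple and undirected. Write $[\ell]=\{1,\ldots,\ell\}$. For positive integers $\ell_1,\ldots,\ell_d$, the $d$-dimensional $\ell_1\times\cdots\times\ell_d$-grid is the graph with node set $\prod_{i=1}^d[\ell_i]$ in which two nodes are adjacent iff they differ in exactly one coordinate, and there by exactly $1$. Its aspect ratio is $\max_{i,j}\ell_j/\ell_i$. An embedding of a graph $G$ into a graph $H$ is a pair $\langle\phi,\rho\rangle$ where $\phi:V(G)\to V(H)$ is injective and $\rho$ assigns to each edge $(u,v)$ of $G$ the edge set of a path in $H$ connecting $\phi(u)$ and $\phi(v)$. Its edge-congestion is the maximum, over edges $e'$ of $H$, of the number of edges of $G$ whose assigned path contains $e'$. *)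

(* Defs.v *)
From mathcomp Require Import all_boot all_order all_algebra.
From mathcomp Require Import reals.
Set Implicit Arguments.
Unset Strict Implicit.
Unset Printing Implicit Defensive.

Record sgraph := SGraph {
  vertex :> finType;
  adj : rel vertex;
  adj_sym : symmetric adj;
  adj_irrefl : irreflexive adj }.

Arguments adj {s}.

(* Undirected edges are unordered pairs of adjacent nodes. *)
Definition edges (G : sgraph) : {set {set G}} :=
  [set e | [exists u : G, exists v : G, adj u v && (e == [set u; v])]].

Definition max_degree (G : sgraph) : nat :=
  \max_(v : G) #|[set w | adj v w]|.

(* [ucycle adj c] also holds for the degenerate closed walks [::] and
   [:: x; y] with x, y adjacent; a genuine cycle has at least three nodes. *)
Definition is_tree (T : sgraph) : Prop :=
  [/\ 0 < #|T|,
      forall x y : T, connect adj x y &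
      forall c : seq T, ucycle adj c -> size c <= 2].

(* The last clause says that the tree nodes whose bag contains v induce a
   connected subgraph of T. *)
Definition is_tree_decomposition (G T : sgraph) (bag : T -> {set G}) : Prop :=
  [/\ is_tree T,
      forall v : G, exists x : T, v \in bag x,
      forall u v : G, adj u v -> exists x : T, (u \in bag x) && (v \in bag x) &
      forall (v : G) (x y : T), v \in bag x -> v \in bag y ->
        connect [rel a b : T | [&& adj a b, v \in bag a & v \in bag b]] x y].

(* For the graph without nodes, width -1 becomes 0 by truncation; this does
   not affect comparisons with natural bounds. *)
Definition width (G T : sgraph) (bag : T -> {set G}) : nat :=
  (\max_(x : T) #|bag x|).-1.

Definition treewidth_at_most (G : sgraph) (t : nat) : Prop :=
  exists (T : sgraph) (bag : T -> {set G}),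
    is_tree_decomposition bag /\ width bag <= t.

(* Coordinates of the l_0 x ... x l_(d-1) grid are numbered from 0: the i-th
   coordinate ranges over {0, ..., l i - 1} instead of {1, ..., l i}. *)
Definition grid_node (d : nat) (l : 'I_d -> nat) : finType :=
  {dffun forall i : 'I_d, 'I_(l i)}.

Definition grid_adj (d : nat) (l : 'I_d -> nat) : rel (grid_node l) :=
  fun x y => [exists i : 'I_d,
    (((x i).+1 == y i :> nat) || ((y i).+1 == x i :> nat))
    && [forall j : 'I_d, (j != i) ==> (x j == y j)]].

Lemma grid_adj_sym (d : nat) (l : 'I_d -> nat) : symmetric (@grid_adj d l).
Proof.
move=> x y; rewrite /grid_adj; apply: eq_existsb => i; rewrite orbC.
by congr (_ && _); apply: eq_forallb => j; rewrite (eq_sym (x j)).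
Qed.

Lemma grid_adj_irrefl (d : nat) (l : 'I_d -> nat) :
  irreflexive (@grid_adj d l).
Proof.
move=> x; apply/existsP => -[i /andP[]].
by rewrite orbb (gtn_eqF (ltnSn (x i))).
Qed.

Definition grid (d : nat) (l : 'I_d -> nat) : sgraph :=
  SGraph (@grid_adj_sym d l) (@grid_adj_irrefl d l).

Definition aspect_ratio (R : realType) (d : nat) (l : 'I_d -> nat) : R :=
  (\big[Num.max/0]_(i < d) \big[Num.max/0]_(j < d) ((l j)%:R / (l i)%:R))%R.

(* Edge set of the walk x :: p. *)
Definition walk_edges (V : finType) (x : V) (p : seq V) : {set {set V}} :=
  [set [set q.1; q.2] | q in zip (x :: p) p].

Definition is_path (H : sgraph) (x : H) (p : seq H) (y : H) : Prop :=
  [/\ path adj x p, last x p = y & uniq (x :: p)].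

(* [rho] is only meaningful on the edges of G. *)
Record embedding (G H : sgraph) := Embedding {
  phi : G -> H;
  rho : {set G} -> {set {set H}};
  phi_inj : injective phi;
  rho_path : forall u v : G, adj u v ->
    exists2 p : seq H, is_path (phi u) p (phi v)
                     & rho [set u; v] = walk_edges (phi u) p }.

Definition edge_congestion (G H : sgraph) (E : embedding G H) : nat :=
  \max_(e' in edges H) #|[set e in edges G | e' \in rho E e]|.

(* Main.v *)
Require Import Defs.
From mathcomp Require Import all_boot all_order all_algebra.
From mathcomp Require Import reals zify.
Set Implicit Arguments.
Unset Strict Implicit.
Unset Printing Implicit Defensive.

(* Small separators give every vertex set S an ordering all of whose prefixes
   cut O(Delta log |S|) edges inside S.  A suitable cyclic window of that
   ordering splits S into two parts of prescribed sizes so that the edges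
   leaving S are shared proportionally; hence, when the grid is recursively
   halved along a longest side, the part of G placed in a box of volume n has
   only O(Delta log n) edges leaving it.

   Each such edge receives a port in the box, whose first two coordinates lie
   in a class of integers attached to the size of the box.  Log n is so small
   compared with the side lengths that the classes can be chosen sparse and
   disjoint, namely by 2-adic valuation, while only O(Delta) ports share a
   coordinate.  A port of a half box is joined to a port of the box by a route
   that moves in the first direction while its second coordinate is that of
   the former, and then in the other directions while its first coordinate is
   that of the latter.  A grid edge is therefore used only by those boxes
   containing it that are attached to the class of one of its coordinates,
   and there are O(1) of them. *)

(** * Orderings of small cutwidth *)

Section Multigraph.
Variables (V E : finType) (s t : E -> V) (Dl : nat).

Definition cut (S : {set V}) : {set E} := [set e | (s e \in S) (+) (t e \in S)].

Definition inner (S : {set V}) : {set E} := [set e | (s e \in S) && (t e \in S)].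

Definition incident (S : {set V}) : {set E} := [set e | (s e \in S) || (t e \in S)].

Definition cutwidth_le (S : {set V}) (K : nat) : Prop :=
  exists o : seq V, [/\ uniq o, o =i S &
    forall k, #|inner S :&: cut [set v in take k o]| <= K].

Hypothesis degree_le : forall v, #|incident [set v]| <= Dl.

Lemma card_bigcup_le (I T : finType) (A : {set I}) (F : I -> {set T}) m :
  (forall i, i \in A -> #|F i| <= m) -> #|\bigcup_(i in A) F i| <= m * #|A|.
Proof.
move=> leF; rewrite mulnC -sum_nat_const.
apply: leq_trans (leq_sum _ leF).
elim/big_rec2: _ => [|i k B _ leB]; first by rewrite cards0.
by apply: leq_trans (leq_card_setU _ _) _; rewrite leq_add2l.
Qed.

Lemma card_incident (X : {set V}) : #|incident X| <= Dl * #|X|.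
Proof.
apply: leq_trans (card_bigcup_le (fun v _ => degree_le v)).
apply/subset_leq_card/subsetP=> e; rewrite inE => /orP[] eX; apply/bigcupP.
  by exists (s e) => //; rewrite !inE eqxx.
by exists (t e) => //; rewrite !inE eqxx orbT.
Qed.

Lemma cutwidth_no_inner (S : {set V}) : inner S = set0 -> cutwidth_le S 0.
Proof.
move=> S0; exists (enum S); split=> [|v|k]; first exact: enum_uniq.
  by rewrite mem_enum.
by rewrite S0 set0I cards0.
Qed.

Lemma cutwidth_mono (S : {set V}) K L :
  K <= L -> cutwidth_le S K -> cutwidth_le S L.
Proof.
move=> leKL [o [Uo oS le]]; exists o; split=> // k.
exact: leq_trans (le k) leKL.
Qed.

(** Concatenate the two orderings: no edge joins [A] to [B], so an edge cut by a prefix lies inside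
    the part in which that prefix ends. *)
Lemma cutwidth_union (A B : {set V}) K :
  [disjoint A & B] -> inner (A :|: B) = inner A :|: inner B ->
  cutwidth_le A K -> cutwidth_le B K -> cutwidth_le (A :|: B) K.
Proof.
move=> dAB eAB [o [Uo oA leo]] [o' [Uo' oB leo']].
have notAB v : v \in A -> v \in B -> False.
  by move=> vA; apply/negP; rewrite (disjointFr dAB).
exists (o ++ o'); split=> [|v|k].
- rewrite cat_uniq Uo Uo' andbT /=; apply/hasPn=> v /=; rewrite oB oA => vB.
  by apply/negP=> vA; apply: notAB vA vB.
- by rewrite mem_cat inE oA oB.
rewrite take_cat; case: ltnP => [_|le_k].
  apply: leq_trans (leo k); apply/subset_leq_card/subsetP=> e.
  rewrite inE eAB !inE => /andP[/orP[/andP[-> ->]//|/andP[sB tB]]].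
  have nin v : v \in B -> v \in take k o = false.
    move=> vB; apply/negP=> /mem_take; rewrite oA => vA; exact: notAB vA vB.
  by rewrite !nin.
apply: leq_trans (leo' (k - size o)); apply/subset_leq_card/subsetP=> e.
rewrite inE eAB !inE !mem_cat !oA => /andP[/orP[/andP[-> ->]//|/andP[sB tB]]].
have nin v : v \in B -> v \in A = false.
  by move=> vB; apply/negP=> vA; exact: notAB vA vB.
by rewrite !nin //= sB tB.
Qed.

(** Put [X :\: A] in front of the ordering of [A]: every additional cut edge is incident with
    [X]. *)
Lemma cutwidth_add (X A : {set V}) K :
  cutwidth_le A K -> cutwidth_le (X :|: A) (K + Dl * #|X|).
Proof.
move=> [o [Uo oA leo]]; exists (enum (X :\: A) ++ o); split=> [|v|k].
- rewrite cat_uniq Uo enum_uniq andbT /=; apply/hasPn=> v /=.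
  by rewrite oA mem_enum inE => ->.
- by rewrite mem_cat oA mem_enum !inE; case: (v \in A); rewrite ?orbT ?orbF.
rewrite addnC; apply: leq_trans (leq_add (card_incident X)
  (leo (k - size (enum (X :\: A))))).
apply: leq_trans (leq_card_setU _ _); apply/subset_leq_card/subsetP=> e.
rewrite !inE; case: (s e \in X) => //=; case: (t e \in X) => //=.
rewrite take_cat; case: ltnP => [lt_k|le_k].
  move=> /andP[/andP[sA tA]].
  have nin v : v \in A -> v \in take k (enum (X :\: A)) = false.
    by move=> vA; apply/negP=> /mem_take; rewrite mem_enum inE vA.
  by rewrite !nin.
by rewrite !mem_cat !mem_enum !inE => /andP[/andP[-> ->]].
Qed.

(** [f] groups the components left after deleting [X]. A class spanning no edge may have any size;
    this accommodates the isolated nodes that later pad [G]. *)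
Definition has_separators (c : nat) : Prop :=
  forall S : {set V}, exists (X : {set V}) (I : finType) (f : V -> I),
    [/\ #|X| <= c,
        forall e, e \in inner (S :\: X) -> f (s e) = f (t e) &
        forall i, let C := [set v in S :\: X | f v == i] in
          2 * #|C| <= #|S| \/ inner C = set0].

(** List the separator first, then the classes one after another. A separator costs [c * Dl], and
    halving the size lowers the logarithm by one. *)
Lemma cutwidth_log (c : nat) (S : {set V}) : has_separators c ->
  cutwidth_le S (c * Dl * (trunc_log 2 #|S|).+1).
Proof.
move=> sep; have [n] := ubnP #|S|; elim: n S => // n IH S /ltnSE le_n.
have [->|/set0Pn[v0 v0S]] := eqVneq S set0.
  by apply: cutwidth_mono (cutwidth_no_inner _) => //; apply/setP=> e; rewrite !inE.
have S_gt0 : 0 < #|S| by apply/card_gt0P; exists v0.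
have [X [I [f [Xc fE fC]]]] := sep S.
set K := c * Dl * trunc_log 2 #|S|.
have cls i : cutwidth_le [set v in S :\: X | f v == i] K.
  case: (fC i) => [|C0]; last exact: cutwidth_mono (cutwidth_no_inner C0).
  set C := [set v in _ | _]; have [->|/set0Pn[v1 v1C] leC] := eqVneq C set0.
    by move=> _; apply: cutwidth_mono (cutwidth_no_inner _) => //;
       apply/setP=> e; rewrite !inE.
  (* Doubling raises [trunc_log 2] by one only for positive arguments. *)
  have C_gt0 : 0 < #|C| by apply/card_gt0P; exists v1.
  apply: cutwidth_mono (IH C _); last by lia.
  by rewrite leq_mul2l -trunc_log2_double // -mul2n leq_trunc_log ?orbT.
have all_cls : cutwidth_le (S :\: X) K.
  have -> : S :\: X = [set v in S :\: X | f v \in enum I].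
    by apply/setP=> v; rewrite !inE mem_enum andbT.
  elim: (enum I) (enum_uniq I) => [|i r IHr] /= => [_|/andP[ir Ur]].
    apply: cutwidth_mono (cutwidth_no_inner _) => //.
    by apply/setP=> e; rewrite !inE !andbF.
  have -> : [set v in S :\: X | f v \in i :: r] =
    [set v in S :\: X | f v == i] :|: [set v in S :\: X | f v \in r].
    by apply/setP=> v; rewrite !inE -andb_orr.
  apply: cutwidth_union (IHr Ur) => //.
    rewrite -setI_eq0; apply/eqP/setP=> v; rewrite !inE.
    by case: eqP => [->|]; rewrite ?(negPf ir) !(andbF, andFb).
  apply/setP=> e; rewrite !inE.
  case: (boolP (e \in inner (S :\: X))) => [eS|].
    move: (eS); rewrite (fE e eS) !inE => /andP[-> ->] /=.
    by case: (f (t e) == i); case: (f (t e) \in r).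
  rewrite !inE negb_and => /orP[]/negPf->; by rewrite ?andbF.
have -> : S = (S :&: X) :|: (S :\: X) by rewrite setID.
apply: cutwidth_mono (cutwidth_add _ all_cls).
rewrite setID -/K mulnS addnC leq_add2r (mulnC c) leq_mul2l.
by rewrite (leq_trans (subset_leq_card (subsetIr S X)) Xc) orbT.
Qed.

End Multigraph.

(** * Proportional splitting *)

Lemma sum_period (g : nat -> nat) n j : (forall k, g (k + n) = g k) ->
  \sum_(i < n) g (j + i) = \sum_(i < n) g i.
Proof.
move=> gn; elim: j => [|j <-]; first by apply: eq_bigr.
case: n gn => [|n] gn; first by rewrite !big_ord0.
rewrite big_ord_recr big_ord_recl /= addn0 addSnnS gn addnC.
by congr (_ + _); apply: eq_bigr => i _; rewrite addSnnS.
Qed.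

(* By double counting the average window sum is n1/n of the total, and moving
   the window by one step changes its sum by at most D. *)
Lemma average_window (g : nat -> nat) n n1 D :
    0 < n -> (forall k, g (k + n) = g k) -> (forall k, g k <= D) ->
  exists2 i, i < n &
    n * (\sum_(j < n1) g (i + j)) <= n1 * (\sum_(k < n) g k) + n * D /\
    n1 * (\sum_(k < n) g k) <= n * (\sum_(j < n1) g (i + j)) + n * D.
Proof.
move=> n_gt0 gn gD; set tot := \sum_(k < n) g k.
pose f i := \sum_(j < n1) g (i + j).
have fn i : f (i + n) = f i.
  by apply: eq_bigr => j _; rewrite addnAC gn.
have fmod i : f (i %% n) = f i.
  rewrite {2}(divn_eq i n); elim: (i %/ n) => // q ->.
  by rewrite mulSn -addnA (addnC n) fn.
have sumf : \sum_(i < n) f i = n1 * tot.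
  rewrite exchange_big /= (eq_bigr (fun=> tot)) ?sum_nat_const ?card_ord //.
  move=> j _; rewrite /tot -(sum_period j gn).
  by apply: eq_bigr => i _; rewrite addnC.
have fS i : f i.+1 <= f i + D.
  rewrite /f; case: (n1) => [|m]; first by rewrite !big_ord0.
  rewrite big_ord_recr big_ord_recl /=.
  have -> : \sum_(j < m) g (i + bump 0 j) = \sum_(j < m) g (i.+1 + j).
    by apply: eq_bigr => j _; rewrite /bump add1n addSnnS.
  rewrite -[X in _ <= X]addnA addnCA leq_add2l.
  exact: leq_trans (gD _) (leq_addl _ _).
suff [i [le1 le2]] : exists i, n * f i <= n1 * tot + n * D /\
    n1 * tot <= n * f i + n * D.
  by exists (i %% n); rewrite ?ltn_mod // -/(f (i %% n)) fmod.
(* Some window is at most the average, and some later one is at least the average. *)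
have [i0 lo] : exists i, n * f i <= n1 * tot.
  case: (boolP [exists i : 'I_n, n * f i <= n1 * tot]).
    by case/existsP=> i; exists i.
  rewrite negb_exists => /forallP all_gt.
  have : \sum_(i < n) (n1 * tot).+1 <= \sum_(i < n) n * f i.
    by apply: leq_sum => i _; rewrite ltnNge all_gt.
  by rewrite sum_nat_const card_ord -big_distrr /= sumf leq_pmul2l ?ltnn.
have [k hi] : exists k, n1 * tot <= n * f (i0 + k).
  case: (boolP [exists i : 'I_n, n1 * tot <= n * f i]).
    case/existsP=> i hi; exists (i0 * n + i - i0).
    have le_i0 : i0 <= i0 * n + i.
      exact: leq_trans (leq_pmulr i0 n_gt0) (leq_addr _ _).
    by rewrite (subnKC le_i0) -fmod modnMDl fmod.
  rewrite negb_exists => /forallP all_gt.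
  have : \sum_(i < n) (n * f i).+1 <= \sum_(i < n) n1 * tot.
    by apply: leq_sum => i _; rewrite ltnNge all_gt.
  rewrite sum_nat_const card_ord; under eq_bigr do rewrite -addn1.
  rewrite big_split /= -big_distrr /= sumf sum_nat_const card_ord muln1.
  by rewrite -[X in _ <= X]addn0 leq_add2l leqNgt n_gt0.
(* Take the first window from [i0] on that reaches the average. If it is the one at [i0], equality
   holds there; otherwise its predecessor is below the average by at most [D]. *)
case: (ex_minnP (ex_intro (fun k => n1 * tot <= n * f (i0 + k)) k hi)) => m hm minm.
case: m hm minm => [|m] hm minm.
  by exists i0; rewrite addn0 in hm; split; lia.
have lt_m : n * f (i0 + m) < n1 * tot.
  by rewrite ltnNge; apply/negP=> /minm; rewrite ltnn.
exists (i0 + m); have := fS (i0 + m).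
rewrite -(leq_pmul2l n_gt0) mulnDr -addnS => le_S.
split; first exact: leq_trans (ltnW lt_m) (leq_addr _ _).
exact: leq_trans hm le_S.
Qed.

Lemma nth_rot_mod (T : Type) (x0 : T) i (o : seq T) j :
  i < size o -> j < size o -> nth x0 (rot i o) j = nth x0 o ((i + j) %% size o).
Proof.
move=> lt_i lt_j; rewrite /rot nth_cat size_drop nth_drop.
case: ltnP => [lt_ij|le_ij]; first by rewrite modn_small //; lia.
rewrite nth_take; last by lia.
have -> : i + j = (j - (size o - i)) + size o by lia.
by rewrite modnDr modn_small //; lia.
Qed.

Section Split.
Variables (V E : finType) (s t : E -> V) (Dl : nat).
Hypothesis degree_le : forall v, #|incident s t [set v]| <= Dl.

Local Notation cut := (cut s t).
Local Notation inner := (inner s t).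

(** An edge of [cut A] either leaves [S], and then its end in [S] lies in [A], or has both ends in
    [S]. *)
Lemma cut_split_bound (S A : {set V}) : A \subset S ->
  #|cut A| <= #|[set e in cut S | (if s e \in S then s e else t e) \in A]|
              + #|inner S :&: cut A|.
Proof.
move=> /subsetP AS; apply: leq_trans (leq_card_setU _ _).
apply/subset_leq_card/subsetP=> e; rewrite !inE.
case: (boolP (s e \in S)) => [sS|/(contraNN (AS _))/negPf->].
  case: (boolP (t e \in S)) => [|/(contraNN (AS _))/negPf->].
    by case: (s e \in A) (t e \in A) => [] [].
  by case: (s e \in A).
case: (boolP (t e \in S)) => [_|/(contraNN (AS _))/negPf->] //=.
by case: (t e \in A).
Qed.

(** Weigh each node of [S] by the edges of [cut S] ending there, and let [A] be a cyclic window of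
    the ordering with nearly average weight. A window is delimited by two prefixes, so it cuts at
    most [2 * K] edges inside [S]. *)
Lemma balanced_split (S : {set V}) n1 n2 K :
    #|S| = n1 + n2 -> 0 < n1 -> cutwidth_le s t S K ->
  exists A : {set V}, [/\ A \subset S, #|A| = n1,
    (n1 + n2) * #|cut A| <= n1 * #|cut S| + (n1 + n2) * (Dl + 2 * K) &
    (n1 + n2) * #|cut (S :\: A)| <= n2 * #|cut S| + (n1 + n2) * (Dl + 2 * K)].
Proof.
move=> cardS n1_gt0 [o [Uo oS cutK]]; set n := n1 + n2.
have n_gt0 : 0 < n by rewrite addn_gt0 n1_gt0.
have size_o : size o = n by rewrite -(card_uniqP Uo) (eq_card oS).
have [v0 _] : exists v0, v0 \in S by apply/card_gt0P; rewrite cardS.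
pose h e := if s e \in S then s e else t e.
pose wt v := #|[set e in cut S | h e == v]|.
have sum_wt (A : {set V}) : \sum_(v in A) wt v = #|[set e in cut S | h e \in A]|.
  rewrite -sum1_card (partition_big h (mem A)) => [|e]; last by rewrite !inE => /andP[].
  apply: eq_bigr => v vA; rewrite /wt -sum1_card; apply: eq_bigl => e.
  by rewrite !inE; case: eqP => [->|]; rewrite ?vA !(andbT, andbF).
have wt_le v : wt v <= Dl.
  apply: leq_trans (degree_le v); apply/subset_leq_card/subsetP=> e.
  by rewrite !inE /h => /andP[_]; case: ifP => _ ->; rewrite ?orbT.
have [i lt_i [le1 le2]] := @average_window (fun k => wt (nth v0 o (k %% n))) n n1 Dl
  n_gt0 (fun k => congr1 (fun m => wt (nth v0 o m)) (modnDr k n)) (fun k => wt_le _).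
pose A := [set v in take n1 (rot i o)].
have AS : A \subset S.
  by apply/subsetP=> v; rewrite inE => /mem_take; rewrite mem_rot oS.
have Ur : uniq (take n1 (rot i o)) by rewrite take_uniq ?rot_uniq.
have sz : size (take n1 (rot i o)) = n1 by rewrite size_takel ?size_rot ?size_o ?leq_addr.
have cardA : #|A| = n1 by rewrite cardsE (card_uniqP Ur).
have sumA : \sum_(v in A) wt v = \sum_(j < n1) wt (nth v0 o ((i + j) %% n)).
  rewrite (eq_bigl [in take n1 (rot i o)]) => [|v]; last by rewrite inE.
  rewrite -big_uniq //= (big_nth v0) sz big_mkord; apply: eq_bigr => j _.
  rewrite nth_take // nth_rot_mod size_o //.
  by rewrite (leq_trans (ltn_ord j)) ?leq_addr.
have sumS : \sum_(k < n) wt (nth v0 o (k %% n)) = #|cut S|.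
  have -> : #|cut S| = \sum_(v in S) wt v.
    rewrite sum_wt; apply/eq_card=> e; rewrite !inE /h.
    case sS: (s e \in S); first by rewrite sS andbT.
    by case: (t e \in S).
  rewrite -(eq_bigl _ _ oS) -big_uniq //= (big_nth v0) size_o big_mkord.
  by apply: eq_bigr => k _; rewrite modn_small.
rewrite -sumA sumS in le1 le2.
have innerA : #|inner S :&: cut A| <= 2 * K.
  (* The window starts at [i] and ends at [m]. It is a difference of two prefixes, or, if it wraps
     around, a prefix together with the complement of a longer one. *)
  pose m := if i + n1 <= n then i + n1 else i + n1 - n.
  have memA v : v \in S -> (v \in A) =
    if i + n1 <= n then (v \in take m o) && (v \notin take i o)
    else (v \in take m o) || (v \notin take i o).
    rewrite inE /m /rot take_cat size_drop size_o -oS => vo.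
    have nin w : w \in drop i o -> w \in take i o = false.
      move: Uo; rewrite -{1}(cat_take_drop i o) cat_uniq => /and3P[_ /hasPn h0 _].
      by move=> /h0/negPf.
    have in_or : (v \in take i o) || (v \in drop i o) by rewrite -mem_cat cat_take_drop.
    case: (leqP (i + n1) n) => le_in.
      rewrite takeD mem_cat; have -> : (n1 < n - i) = (n1 != n - i) by lia.
      case: eqP => [-> | _] /=.
        rewrite subnn take0 cats0 (@take_oversize _ _ (drop i o)) ?size_drop ?size_o //.
        move: in_or (nin v); case: (v \in drop _ _) => [_ ->//|].
        by rewrite !orbF => ->.
      case: (boolP (v \in take n1 (drop i o))) => [/mem_take/nin->//|_].
      by rewrite orbF; case: (v \in _).
    rewrite ltnNge (_ : n - i <= n1) //=; last by lia.
    have -> : n1 - (n - i) = i + n1 - n by lia.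
    rewrite take_takel; last by lia.
    rewrite mem_cat orbC; congr (_ || _).
    case: (boolP (v \in drop i o)) => [/nin->//|/negPf h1].
    by move: in_or; rewrite h1 orbF => ->.
  rewrite mul2n -addnn; apply: leq_trans (leq_add (cutK i) (cutK m)).
  apply: leq_trans (leq_card_setU _ _); apply/subset_leq_card/subsetP=> e.
  rewrite !inE => /andP[/andP[sS tS]]; move: (memA _ sS) (memA _ tS).
  rewrite !inE => -> ->; rewrite sS tS /=.
  by case: ifP => _; move: (s e \in take m o) (t e \in take m o)
    (s e \in take i o) (t e \in take i o) => [] [] [] [].
exists A; split=> //.
  rewrite mulnDr addnA; apply: leq_trans (leq_mul (leqnn n) (cut_split_bound AS)) _.
  by rewrite mulnDr leq_add ?leq_mul2l ?innerA ?orbT // -sum_wt.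
have DS : S :\: A \subset S by rewrite subsetDl.
apply: leq_trans (leq_mul (leqnn n) (cut_split_bound DS)) _.
have -> : inner S :&: cut (S :\: A) = inner S :&: cut A.
  by apply/setP=> e; rewrite !inE; case: (s e \in S) (t e \in S) => [] [] //=;
     rewrite !andbT; case: (s e \in _) (t e \in _) => [] [].
(* The lower bound on the weight of the window becomes an upper bound on the weight of its
   complement. *)
have eqD : #|[set e in cut S | h e \in A]| + #|[set e in cut S | h e \in S :\: A]| = #|cut S|.
  rewrite -[RHS](cardsID [set e | h e \in A]); congr (_ + _); apply: eq_card => e.
    by rewrite !inE.
  rewrite !inE /h; case sS: (s e \in S); first by rewrite sS andbT andbC.
  by case tS: (t e \in S); rewrite ?andbF // andbT andbC.
rewrite -sum_wt in eqD; rewrite -/h.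
move: eqD le2 innerA; rewrite /n; move: (\sum_(v in A) wt v) #|_| #|_| #|_| => a b c f.
nia.
Qed.
End Split.

(** * Centroids of tree decompositions *)

Section Separator.
Variables (G T : sgraph) (bag : T -> {set G}).
Hypothesis Tdec : is_tree_decomposition bag.

(** The components of this relation are the branches of [T] at [x], together with [x] as an isolated
    node. *)
Definition avoid (x : T) : rel T := [rel a b | [&& adj a b, a != x & b != x]].

Lemma avoid_sym x : connect_sym (avoid x).
Proof.
by apply: sym_connect_sym => a b; rewrite /avoid /= adj_sym andbA andbAC -andbA.
Qed.

Lemma connect_avoid_neq x a b : a != x -> connect (avoid x) a b -> b != x.
Proof.
move=> ax /connectP[p]; elim: p a ax => [|c p IH] a ax /=; first by move=> _ ->.
by move=> /andP[/and3P[_ _ cx]] /IH; apply.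
Qed.

Lemma path_avoid x a p : path adj a p -> x \notin a :: p -> path (avoid x) a p.
Proof.
elim: p a => //= b p IH a /andP[ab bp]; rewrite inE negb_or => /andP[xa xp].
rewrite IH // andbT /avoid /= ab eq_sym xa.
by move: xp; rewrite inE negb_or eq_sym => /andP[].
Qed.

Lemma avoid_path x a p : path (avoid x) a p -> path adj a p.
Proof. by apply: sub_path => b c /and3P[]. Qed.

(** Two distinct neighbours of [z] in one branch would close a cycle through [z]. *)
Lemma tree_branch (x y z : T) :
  adj z y -> adj z x -> connect (avoid z) y x -> y = x.
Proof.
case: Tdec => [[_ _ acyclic] _ _ _] zy zx /connectP[p0 yp0 last_p0].
case: (shortenP yp0) last_p0 => p yp Uyp _ last_p.
have yz : y != z by apply: contraTneq zy => ->; rewrite adj_irrefl.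
have sub : path adj y p by exact: avoid_path yp.
have z_notin : z \notin y :: p.
  by apply/negP=> zp; have := connect_avoid_neq yz (path_connect yp zp); rewrite eqxx.
have := acyclic (z :: y :: p); rewrite /ucycle /= rcons_path -last_p.
rewrite zy sub adj_sym zx /= in_cons; move: z_notin Uyp; rewrite inE => -> /= ->.
by case: p last_p {yp sub} => [->//|c p _ /(_ isT)].
Qed.

(** On a simple path from [z] to [a] avoiding [x], the second node is a neighbour of [z] in the
    branch of [a] at [z]. If that branch also contained [x], this neighbour would be [x] by
    [tree_branch]. *)
Lemma avoid_disjoint (x z a : T) : adj x z ->
  connect (avoid x) z a -> connect (avoid z) x a -> False.
Proof.
move=> xz cza cxa.
have nxz : x != z by apply: contraTneq xz => ->; rewrite adj_irrefl.
have az : a != z by apply: connect_avoid_neq cxa.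
case/connectP: cza => p0 zp0 last_p0.
case: (shortenP zp0) last_p0 => -[|w p] /= zp Uzp _ last_a; first by rewrite last_a eqxx in az.
case/andP: zp => /and3P[zw _ wx] wp; move: Uzp => /andP[]; rewrite inE negb_or => /andP[zNw zNp] _.
suff cwa : connect (avoid z) w a.
  have := tree_branch zw (_ : adj z x) (connect_trans cwa _).
  rewrite adj_sym xz avoid_sym => /(_ isT cxa) eq_wx.
  by rewrite eq_wx eqxx in wx.
apply/connectP; exists p => //; apply: path_avoid (avoid_path wp) _.
by rewrite inE negb_or zNw.
Qed.

(* Otherwise every node has a neighbour towards a majority of the weight;
   choose such a pair x, z with the branch at z smallest. *)
Lemma tree_centroid (beta : G -> T) (U : {set G}) :
  exists x : T, forall y, y != x ->
    2 * #|[set v in U | connect (avoid x) y (beta v)]| <= #|U|.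
Proof.
case: (Tdec) => [[T_gt0 conn _] _ _ _].
pose heavy x y := #|U| < 2 * #|[set v in U | connect (avoid x) y (beta v)]|.
case: (boolP [exists x, [forall y, (y != x) ==> ~~ heavy x y]]) => [|no].
  case/existsP=> x /forallP h; exists x => y yx.
  by have := h y; rewrite yx /= -leqNgt.
(* A heavy branch at [x] contains a neighbour of [x], which can represent it. *)
have {}no x : exists2 z, adj x z & heavy x z.
  have := no; rewrite negb_exists => /forallP/(_ x).
  rewrite negb_forall => /existsP[y]; rewrite negb_imply negbK => /andP[yx hy].
  case/connectP: (conn x y) => p0 xp0 last_p0.
  case: (shortenP xp0) last_p0 => -[|z p] /= xp Uxp _ last_y; first by rewrite last_y eqxx in yx.
  case/andP: xp => xz zp; exists z => //; rewrite /heavy.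
  suff czy : connect (avoid x) z y.
    rewrite (_ : [set v in U | _] = [set v in U | connect (avoid x) y (beta v)]) //.
    by apply/setP=> v; rewrite !inE (same_connect (avoid_sym x) czy).
  apply/connectP; exists p => //; apply: path_avoid zp _.
  by case/andP: Uxp.
have [x0 _] : exists x0 : T, x0 \in T by apply/card_gt0P.
have [z0 xz0 h0] := no x0.
pose P (q : T * T) := adj q.1 q.2 && heavy q.1 q.2.
have P0 : P (x0, z0) by rewrite /P xz0.
case: (@arg_minnP _ (x0, z0) P (fun q => #|connect (avoid q.1) q.2|) P0).
move=> [x z] /andP[/= xz hxz] min_xz.
have [z' zz' hzz'] := no z.
(* If [z'] is [x], two disjoint branches would both carry more than half of the weight. *)
have [eq_z'|z'x] := eqVneq z' x.
  move: hxz hzz'; rewrite /heavy eq_z' => hx hz.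
  suff : #|[set v in U | connect (avoid x) z (beta v)]|
       + #|[set v in U | connect (avoid z) x (beta v)]| <= #|U| by lia.
  rewrite -cardsUI [X in _ + X](_ : _ = 0) ?addn0.
    by apply/subset_leq_card/subsetP=> v; rewrite !inE -andb_orr => /andP[].
  apply/eqP; rewrite cards_eq0; apply/eqP/setP=> v; rewrite !inE.
  apply/negP=> /andP[/andP[_ c1] /andP[_ c2]]; exact: avoid_disjoint xz c1 c2.
have zx : adj z x by rewrite adj_sym.
have nzx : z != x by apply: contraTneq xz => ->; rewrite adj_irrefl.
have nz'z : z' != z by apply: contraTneq zz' => ->; rewrite adj_irrefl.
(* Otherwise the branch at [z] towards [z'] lies inside the branch at [x] towards [z] and misses
   [z], against minimality. *)
have sub a : connect (avoid z) z' a -> connect (avoid x) z' a.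
  move=> /connectP[p z'p ->]; apply/connectP; exists p => //.
  apply: path_avoid (avoid_path z'p) _; apply/negP=> xp.
  move: z'x; rewrite (tree_branch zz' zx) ?eqxx //.
  exact: path_connect z'p _ xp.
have /= := min_xz (z, z'); rewrite /P /= zz' hzz' => /(_ isT).
rewrite leqNgt => /negP[]; apply/proper_card/properP; split.
  apply/subsetP=> a; rewrite !inE => /sub; apply: connect_trans.
  by apply: connect1; rewrite /avoid /= zz' nzx z'x.
exists z; rewrite !inE ?connect0 //; apply/negP=> /(connect_avoid_neq nz'z).
by rewrite eqxx.
Qed.

(** The bags containing [v] are connected in [T], and the bag of [x] is not among them. *)
Lemma bag_branch (x z w : T) (v : G) :
  v \in bag z -> v \in bag w -> v \notin bag x -> connect (avoid x) z w.
Proof.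
case: Tdec => _ _ _ conn vz vw vx; case/connectP: (conn v z w vz vw) => p zp ->.
apply/connectP; exists p => //; apply: sub_path zp => a b /and3P[ab va vb].
by rewrite /avoid /= ab /=; apply/andP; split; apply: contraNneq vx => <-.
Qed.

(** The separator is the bag of a centroid [x], and a node is labelled by the branch at [x] holding
    a chosen bag of it. The two ends of an edge share a bag, hence a branch. The summand [X]
    consists of isolated nodes, labelled [None]. *)
Lemma treewidth_separators (n : nat) (X E : finType) (s t : E -> G) :
  (forall x, #|bag x| <= n) -> (forall e, adj (s e) (t e)) ->
  has_separators (fun e => inl (s e) : G + X) (fun e => inl (t e) : G + X) n.
Proof.
move=> bag_n adj_st S; case: (Tdec) => [_ cover edge _].
pose beta v := xchoose (cover v).
have betaP v : v \in bag (beta v) by exact: (xchooseP (cover v)).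
have [x xP] := tree_centroid beta [set v | inl v \in S].
exists (inl @: bag x), (option T : finType), (fun v => if v is inl u then
  Some (fingraph.root (avoid x) (beta u)) else None); split.
- by rewrite card_imset // => a b [].
- move=> e; rewrite !inE !mem_imset => [|a b []|a b []] //.
  move=> /andP[/andP[sx _] /andP[tx _]].
  have [z /andP[sz tz]] := edge _ _ (adj_st e); congr Some.
  apply/(fingraph.rootP (avoid_sym x)); apply: (@connect_trans _ _ z).
    exact: bag_branch (betaP _) sz sx.
  exact: bag_branch tz (betaP _) tx.
case=> [y|]; last by right; apply/setP=> e; rewrite !inE andbF.
have [->|yx] := eqVneq y x.
  (* The component of [x] under [avoid x] is [x] alone, and a node with [beta v = x] lies in the
     separator. *)
  right; apply/setP=> e; rewrite !inE; apply/negP=> /andP[].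
  rewrite mem_imset => [|a b []//]; move=> /andP[/andP[sx _] /eqP[eq_x]] _.
  have : connect (avoid x) x (beta (s e)).
    by have := connect_root (avoid x) (beta (s e)); rewrite eq_x avoid_sym.
  case/connectP=> -[|c p] /=; last by rewrite /avoid /= eqxx andbF.
  by move=> _ eq_b; rewrite -eq_b betaP in sx.
left; have inl_inj : injective (@inl G X) by move=> a b [].
set C := [set v in _ | _].
have leC : #|C| <= #|[set v in [set v | inl v \in S] | connect (avoid x) y (beta v)]|.
  rewrite -(card_imset _ inl_inj); apply/subset_leq_card/subsetP=> -[v|i]; rewrite !inE.
    move=> /andP[/andP[_ vS] /eqP[<-]]; rewrite mem_imset // !inE vS /=.
    by rewrite avoid_sym connect_root.
  by rewrite andbF.
have leS : #|[set v | inl v \in S]| <= #|S|.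
  rewrite -(card_imset _ inl_inj); apply/subset_leq_card/subsetP=> _ /imsetP[v vS ->].
  by rewrite inE in vS.
by have := xP y yx; lia.
Qed.
End Separator.

(** * Lattice points *)

Section Lattice.
Variable D : finType.

(** Coordinates are unbounded, so all boxes of the recursion are predicates on one type. *)
Definition point : Type := {ffun D -> nat}.

Definition set_coord (x : point) (i : D) (v : nat) : point :=
  [ffun k => if k == i then v else x k].

Definition succ_coord (i : D) (x : point) : point := set_coord x i (x i).+1.

Definition in_box (a b : D -> nat) (x : point) : bool :=
  [forall k, a k <= x k < a k + b k].

(* A set of lattice edges is a predicate [P], where [P i x] stands for the
   edge joining [x] and [succ_coord i x]. *)
Inductive joined (P : D -> point -> bool) : point -> point -> Prop :=
| joined_refl x : joined P x x
| joined_edge i x : P i x -> joined P x (succ_coord i x)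
| joined_sym x y : joined P x y -> joined P y x
| joined_trans y x z : joined P x y -> joined P y z -> joined P x z.

Lemma joined_mono (P Q : D -> point -> bool) x y :
  (forall i z, P i z -> Q i z) -> joined P x y -> joined Q x y.
Proof.
move=> PQ; elim=> {x y} [x|i x /PQ|x y _|y x z _ IHx _].
- exact: joined_refl.
- exact: joined_edge.
- exact: joined_sym.
- exact: joined_trans.
Qed.

Lemma set_coord_id x i : set_coord x i (x i) = x.
Proof. by apply/ffunP=> k; rewrite ffunE; case: eqP => [->|]. Qed.

Lemma set_coordE x i v : set_coord x i v i = v.
Proof. by rewrite ffunE eqxx. Qed.

Lemma set_coord_neq x i v k : k != i -> set_coord x i v k = x k.
Proof. by rewrite ffunE => /negPf->. Qed.

Lemma succ_set_coord x i v : succ_coord i (set_coord x i v) = set_coord x i v.+1.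
Proof. by apply/ffunP=> k; rewrite !ffunE eqxx; case: eqP. Qed.

Lemma in_box_set_coord a b x i v :
  in_box a b x -> a i <= v < a i + b i -> in_box a b (set_coord x i v).
Proof.
move=> /forallP xB vB; apply/forallP=> k; rewrite ffunE.
by case: eqP => [->|_].
Qed.

Lemma joined_line (P : D -> point -> bool) x i u v :
  (forall w, minn u v <= w < maxn u v -> P i (set_coord x i w)) ->
  joined P (set_coord x i u) (set_coord x i v).
Proof.
wlog le_uv : u v / u <= v => [IH|].
  case/orP: (leq_total u v) => le_uv Pw; first exact: IH.
  by apply/joined_sym/IH => // w; rewrite minnC maxnC; apply: Pw.
rewrite (minn_idPl le_uv) (maxn_idPr le_uv) -(subnKC le_uv).
elim: (v - u) => [|m IH] Pw; first by rewrite addn0; apply: joined_refl.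
apply: joined_trans (IH _) _ => [w lt_w|]; first by apply: Pw; lia.
by rewrite addnS -succ_set_coord; apply/joined_edge/Pw; lia.
Qed.

Variables (i0 i1 : D).
Hypothesis i01 : i1 != i0.

(* The lattice edges of a box that are available for a route which first
   moves along direction [i0] on the level [u] of coordinate [i1], and then
   along the other directions on the level [v] of coordinate [i0]. *)
Definition bend (a b : D -> nat) (u v : nat) (i : D) (x : point) : bool :=
  [&& in_box a b x, in_box a b (succ_coord i x) &
      if i == i0 then x i1 == u else x i0 == v].

Lemma joined_bend a b (p q : point) : in_box a b p -> in_box a b q ->
  joined (bend a b (p i1) (q i0)) p q.
Proof.
(* [z r] is the point reached from [p] once coordinate [i0] and those in [r] agree with [q]. *)
move=> pB qB; pose z (r : seq D) : point := [ffun k => if (k == i0) || (k \in r) then q k else p k].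
have between x y i w : in_box a b x -> in_box a b y ->
    minn (x i) (y i) <= w < maxn (x i) (y i) ->
    (a i <= w < a i + b i) && (a i <= w.+1 < a i + b i).
  by move=> /forallP/(_ i) xi /forallP/(_ i) yi; lia.
apply: (@joined_trans _ (z [::])).
  have -> : z [::] = set_coord p i0 (q i0).
    by apply/ffunP=> k; rewrite !ffunE orbF; case: eqP => [->|].
  rewrite -{2}(set_coord_id p i0); apply: joined_line => w.
  move=> /(between _ _ _ _ pB qB)/andP[w1 w2].
  by rewrite /bend succ_set_coord !in_box_set_coord //= eqxx set_coord_neq.
have {2}<- : z (enum D) = q by apply/ffunP=> k; rewrite ffunE mem_enum orbT.
elim: (enum D) => [|k r IH]; first exact: joined_refl.
apply: joined_trans IH _.
have [->|ki] := eqVneq k i0.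
  have -> : z (i0 :: r) = z r by apply/ffunP=> k'; rewrite !ffunE inE orbA orbb.
  exact: joined_refl.
have -> : z (k :: r) = set_coord (z r) k (q k).
  by apply/ffunP=> k'; rewrite !ffunE inE; case: (eqVneq k' k) => [->|_]; rewrite ?orbT.
have zB : in_box a b (z r).
  apply/forallP=> k'; rewrite ffunE; case: ifP => _.
    exact: (forallP qB).
  exact: (forallP pB).
rewrite -{1}(set_coord_id (z r) k); apply: joined_line => w.
move=> /(between _ _ _ _ zB qB)/andP[w1 w2].
rewrite /bend succ_set_coord !in_box_set_coord //= (negPf ki).
by rewrite set_coord_neq 1?eq_sym // ffunE eqxx.
Qed.

(** * Volumes of boxes *)

Definition volume (b : D -> nat) : nat := \prod_k b k.

Definition upd (f : D -> nat) (i : D) (v : nat) : D -> nat :=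
  fun k => if k == i then v else f k.

Lemma volume_upd b i v : b i * volume (upd b i v) = v * volume b.
Proof.
rewrite /volume (bigD1 i) // [in RHS](bigD1 i) //= /upd eqxx mulnCA.
by congr (_ * (_ * _)); apply: eq_bigr => k /negPf->.
Qed.

Lemma volume_gt0 b : (forall k, 0 < b k) -> 0 < volume b.
Proof. by move=> b0; apply: prodn_gt0. Qed.

Lemma side_le_volume b i : (forall k, 0 < b k) -> b i <= volume b.
Proof.
by move=> b0; rewrite /volume (bigD1 i) //= leq_pmulr ?prodn_gt0.
Qed.

Lemma volume_le_exp b m : (forall k, b k <= m) -> volume b <= m ^ #|D|.
Proof.
move=> bm; rewrite -prod_nat_const; exact: leq_prod.
Qed.
End Lattice.

(** * Classes of coordinates *)

(* The positive classes consist of the integers of a given 2-adic valuation, so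
   that they are pairwise disjoint, yet meet every long enough interval. *)
Definition coord_class (j c : nat) : bool := (j == 0) || (c %% 2 ^ j.+1 == 2 ^ j).

(** For [j < k], members of class [k] are divisible by [2 ^ j.+1], while those of class [j] leave
    remainder [2 ^ j]. Class 0 contains every integer, whence the positivity assumptions. *)
Lemma coord_class_inj j k c :
  0 < j -> 0 < k -> coord_class j c -> coord_class k c -> j = k.
Proof.
rewrite /coord_class; case: j k => [//|j] [//|k] _ _ /=.
wlog lt_jk : j k / j < k => [IH /eqP cj /eqP ck|/eqP cj /eqP ck].
  case: (ltngtP j k) => [lt|lt|->//]; first by apply: IH; rewrite ?cj ?ck.
  by apply/esym/IH; rewrite ?cj ?ck.
have dv : 2 ^ j.+2 %| 2 ^ k.+1 by rewrite dvdn_exp2l.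
have := modn_dvdm c (dvdn_exp2l 2 (_ : j.+2 <= k.+2)).
rewrite ltnS => /(_ (ltnW lt_jk)); rewrite ck cj (eqP dv) => /esym/eqP.
by rewrite expn_eq0.
Qed.

Lemma coord_class_labels (lo L j : nat) : exists ls : seq nat,
  [/\ uniq ls, forall c, c \in ls -> (lo <= c < lo + L) && coord_class j c &
      (if j == 0 then L else L %/ 2 ^ j.+1) <= size ls].
Proof.
case: j => [|j] /=.
  exists (iota lo L); rewrite iota_uniq size_iota; split=> // c.
  by rewrite mem_iota andbT.
set M := 2 ^ j.+2; set r := 2 ^ j.+1.
have M_gt0 : 0 < M by rewrite expn_gt0.
have rM : r < M by rewrite ltn_exp2l.
(* [q] is the least multiplier with [lo <= q * M + r]. *)
pose q := (lo + M - 1 - r) %/ M; pose f k := (q + k) * M + r.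
have lt_q : lo + M - 1 - r < q * M + M by rewrite /q -mulSnr -ltn_divLR.
have le_q : q * M <= lo + M - 1 - r by rewrite leq_divM.
have f_inj : injective f by move=> k l /addIn/eqP; rewrite eqn_pmul2r // => /eqP/addnI.
exists (map f (iota 0 (L %/ M))); rewrite map_inj_uniq // iota_uniq size_map size_iota.
split=> // c /mapP[k]; rewrite mem_iota /= add0n => lt_k ->.
rewrite /coord_class /= /f modnMDl modn_small // eqxx andbT mulnDl.
have : k.+1 * M <= L by rewrite (leq_trans _ (leq_divM L M)) // leq_mul2r lt_k orbT.
by rewrite mulSn; lia.
Qed.

(** Cut an enumeration of [M] into consecutive blocks of size [A] and give each block its own
    label. *)
Lemma distribute (E : finType) (M : {set E}) (ls : seq nat) A : uniq ls ->
    #|M| <= A * size ls ->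
  exists f : E -> nat, (forall e, e \in M -> f e \in ls) /\
    forall c, #|[set e in M | f e == c]| <= A * (c \in ls).
Proof.
move=> Uls leM; pose pos e := index e (enum M).
have lt_pos e : e \in M -> pos e < #|M| by rewrite cardE index_mem mem_enum.
have lt_div e : e \in M -> pos e %/ A < size ls.
  move=> eM; have lt_e := leq_trans (lt_pos e eM) leM.
  have A_gt0 : 0 < A by case: (A) lt_e.
  by rewrite ltn_divLR // mulnC.
exists (fun e => nth 0 ls (pos e %/ A)); split=> [e /lt_div|c]; first exact: mem_nth.
case: (boolP (c \in ls)) => [cls|ncls]; last first.
  rewrite muln0 leqn0 cards_eq0; apply/eqP/setP=> e; rewrite !inE.
  by apply/negP=> /andP[/lt_div eM /eqP eq_c]; rewrite -eq_c mem_nth in ncls.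
(* For [A = 0] the set [M] is empty; otherwise the position modulo [A] is injective on a block. *)
rewrite muln1; case: A leM lt_div => [|A] leM lt_div.
  apply: leq_trans leM; apply/subset_leq_card/subsetP=> e.
  by rewrite inE => /andP[].
rewrite -[X in _ <= X]card_ord -(card_in_imset (f := fun e => inord (pos e %% A.+1) : 'I_A.+1)).
  exact: max_card.
move=> e e'; rewrite !inE => /andP[eM /eqP eq_c] /andP[eM' /eqP eq_c'].
move=> /(congr1 val); rewrite /= !inordK ?ltn_mod // => eq_mod.
have eq_div : pos e %/ A.+1 = pos e' %/ A.+1.
  apply/eqP; rewrite -(nth_uniq 0 _ _ Uls) ?lt_div //; apply/eqP.
  by rewrite eq_c eq_c'.
have : pos e = pos e' by rewrite (divn_eq (pos e) A.+1) eq_div eq_mod -divn_eq.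
rewrite -(mem_enum M) in eM; rewrite -(mem_enum M) in eM'.
by move=> eq_pos; rewrite -(nth_index e eM) -/(pos e) eq_pos nth_index.
Qed.

(* Squaring makes the level drop at every halving, as (2/3)^2 < 1/2. *)
Definition level (n : nat) : nat := trunc_log 2 (n ^ 2).

Lemma level_lt n1 n : 0 < n1 -> 3 * n1 <= 2 * n -> level n1 < level n.
Proof.
move=> n1_gt0 le_n; rewrite /level -trunc_log2_double ?expn_gt0 ?n1_gt0 //.
apply: leq_trunc_log; rewrite -muln2; nia.
Qed.

Lemma trunc_log_le_level n : 0 < n -> trunc_log 2 n <= level n.
Proof. by move=> n_gt0; apply: leq_trunc_log; rewrite -mulnn leq_pmulr. Qed.

(* [p] levels share a class, and the first levels share class 0. *)
Definition level_class (p off n : nat) : nat := level n %/ p - off.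

(** Along a chain of nested boxes the level strictly drops, so this bounds the number of boxes of
    the chain, from volume [n] down, whose class contains [c]. *)
Definition load_weight (p off n c : nat) : nat :=
  \sum_(m < (level n).+1) coord_class (m %/ p - off) c.

Lemma load_weight_step p off n1 n c : 0 < n1 -> 3 * n1 <= 2 * n ->
  load_weight p off n1 c + coord_class (level_class p off n) c
    <= load_weight p off n c.
Proof.
move=> n1_gt0 /(level_lt n1_gt0) lt_n1; rewrite /load_weight [leqRHS]big_ord_recr /=.
rewrite leq_add2r -(subnKC lt_n1) big_split_ord /=; exact: leq_addr.
Qed.

Lemma card_ord_interval k lo L : #|[set m : 'I_k | lo <= m < lo + L]| <= L.
Proof.
case: L => [|L].
  rewrite leqn0 cards_eq0; apply/eqP/setP=> m; rewrite !inE; lia.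
rewrite -[leqRHS]card_ord -(card_in_imset (f := fun m : 'I_k => inord (m - lo) : 'I_L.+1)).
  exact: max_card.
move=> m m'; rewrite !inE => mL mL' /(congr1 val) /=.
rewrite !inordK; try lia.
by move=> eq_m; apply: val_inj => /=; lia.
Qed.

(** At most [p * off.+1] levels have class 0. The levels of positive class containing [c] all have
    the same class, so there are at most [p] of them. *)
Lemma load_weight_le p off n c : 0 < p -> load_weight p off n c <= p * off.+2.
Proof.
move=> p_gt0; rewrite /load_weight; set k := (level n).+1.
have -> : \sum_(m < k) coord_class (m %/ p - off) c =
    #|[set m : 'I_k | coord_class (m %/ p - off) c]|.
  rewrite -sum1_card big_mkcond [RHS]big_mkcond; apply: eq_bigr => m _.
  by rewrite inE; case: coord_class.
have := card_ord_interval k 0 (p * off.+1).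
case: (boolP [exists m : 'I_k, (0 < m %/ p - off) && coord_class (m %/ p - off) c]).
  case/existsP=> m0 /andP[m0_gt0 m0c].
  have := card_ord_interval k (m0 %/ p * p) p => le2 le1.
  rewrite mulnS addnC; apply: leq_trans (leq_add le1 le2).
  apply: leq_trans (leq_card_setU _ _); apply/subset_leq_card/subsetP=> m.
  rewrite !inE add0n => mc; case: (ltnP m (p * off.+1)) => //= le_m.
  have m_gt0 : 0 < m %/ p - off by rewrite subn_gt0 leq_divRL // mulnC.
  have eq_j := coord_class_inj m_gt0 m0_gt0 mc m0c.
  have -> : m0 %/ p = m %/ p by lia.
  by rewrite leq_divM -mulSnr -ltn_divLR //= ltnSn.
rewrite negb_exists => /forallP no le1.
apply: leq_trans (leq_trans le1 _); last by rewrite leq_mul2l leqnSn orbT.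
apply/subset_leq_card/subsetP=> m; rewrite !inE add0n /= => mc.
have := no m; rewrite mc andbT -leqNgt leqn0 subn_eq0 => le_off.
by rewrite mulnC -ltn_divLR.
Qed.

(** With [j0 = level n %/ (4 * d)], the bound on [n] gives [2 ^ (2 * j0) <= r * L]. A positive class
    has spacing [2 ^ (j0 - r)], and [r < 2 ^ r], so about [2 ^ j0] labels fit into an interval of
    length [L]. *)
Lemma label_room d r n L : 0 < d -> 0 < L -> 0 < n -> n <= (r * L) ^ d ->
  let j := level_class (4 * d) r.+1 n in
  2 ^ (level n %/ (4 * d)) <= (if j == 0 then L else L %/ 2 ^ j.+1) * 2 ^ r.+1.
Proof.
move=> d_gt0 L_gt0 n_gt0 le_n /=; rewrite /level_class.
set j0 := level n %/ (4 * d).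
case: (posnP (j0 - r.+1)) => [/eqP|j_gt0].
  rewrite subn_eq0 => le_j0; apply: leq_trans (leq_pmull _ L_gt0).
  by rewrite leq_exp2l.
have le2 : 2 ^ (2 * j0) <= r * L.
  have d2 : 0 < d * 2 by lia.
  rewrite -(leq_exp2r _ _ d2) expnM -expnM.
  apply: leq_trans (_ : n ^ 2 <= _); last by rewrite expnM leq_exp2r.
  apply: leq_trans (trunc_logP (isT : 1 < 2) (_ : 0 < n ^ 2)); last by rewrite expn_gt0 n_gt0.
  rewrite -expnM leq_exp2l // -/(level n).
  by apply: leq_trans (leq_divM (level n) (4 * d)); rewrite -/j0; nia.
apply: leq_trans (leq_pmulr _ _); last by rewrite expn_gt0.
rewrite leq_divRL ?expn_gt0 // -expnD -(@leq_pmul2l (2 ^ r)) ?expn_gt0 // -expnD.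
apply: leq_trans (leq_trans le2 _); last by rewrite leq_mul2r ltnW ?orbT // ltn_expl.
by rewrite leq_exp2l //; lia.
Qed.

(** The number of ports allowed per coordinate value: [24 * d] is 6 times the [4 * d] levels sharing
    a class, and [2 ^ r.+1] is the loss in [label_room]. *)
Definition port_load (Dl c d r : nat) : nat :=
  Dl * (c * (45 + 24 * d)) * 2 ^ r.+1.

(** [M] has logarithmic size, whereas the number of labels grows like a power of [n]. Here [n1] is
    the volume of a half box and [n] that of the box, whose class the ports use. *)
Lemma port_labels (E : finType) (M : {set E}) d r c Dl n n1 lo L :
    0 < d -> 0 < L -> 0 < n1 -> n1 <= n -> n <= (r * L) ^ d ->
    #|M| <= Dl * (c * (45 + 6 * trunc_log 2 n1)) ->
  exists f : E -> nat, (forall e, e \in M -> lo <= f e < lo + L) /\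
    forall x, #|[set e in M | f e == x]| <=
      port_load Dl c d r * coord_class (level_class (4 * d) r.+1 n) x.
Proof.
move=> d_gt0 L_gt0 n1_gt0 le_n1 le_n leM.
have n_gt0 : 0 < n by apply: leq_trans le_n1.
have [ls [Uls lsP le_ls]] := coord_class_labels lo L (level_class (4 * d) r.+1 n).
have room := label_room d_gt0 L_gt0 n_gt0 le_n.
have leM' : #|M| <= port_load Dl c d r * size ls.
  apply: leq_trans leM _; rewrite /port_load -!mulnA leq_mul2l; apply/orP; right.
  rewrite leq_mul2l; apply/orP; right; rewrite (mulnC (2 ^ _)).
  apply: leq_trans (leq_mul (leqnn _) (leq_trans room (leq_mul le_ls (leqnn _)))).
  have d4 : 0 < 4 * d by lia.
  (* The logarithm is below [4 * d * j0.+1], and [j0.+1 <= 2 ^ j0]. *)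
  have := ltn_ceil (level n) d4; set j0 := level n %/ _ => lt_level.
  have := trunc_log_le_level n1_gt0.
  have := leq_trunc_log 2 (leq_mul le_n1 le_n1); rewrite !mulnn -!/(level _).
  have : j0 < 2 ^ j0 by apply: ltn_expl.
  move: (2 ^ j0) (trunc_log _ _) (level n1) => J u v; nia.
have [f [f_ls f_le]] := distribute Uls leM'.
exists f; split=> [e /f_ls/lsP/andP[]//|x].
apply: leq_trans (f_le x) _; rewrite leq_mul2l; apply/orP; right.
by case: (boolP (x \in ls)) => // /lsP/andP[_ ->].
Qed.

(** Write [u] and [u1] for the logarithms of [n] and [n1]. A part inherits at most two thirds of
    [tot], that is [30 + 4 * u] in units of [Dl * c], and gains at most [3 + 2 * u]. As
    [u <= u1 + 2], the sum [33 + 6 * u] is at most [45 + 6 * u1]. *)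
Lemma boundary_step (n1 n2 tot x Dl c : nat) : let n := n1 + n2 in
    0 < c -> 0 < n1 -> n <= 3 * n1 -> 3 * n1 <= 2 * n ->
    n * x <= n1 * tot + n * (Dl + 2 * (c * Dl * (trunc_log 2 n).+1)) ->
    tot <= Dl * (c * (45 + 6 * trunc_log 2 n)) ->
  x <= Dl * (c * (45 + 6 * trunc_log 2 n1)).
Proof.
move=> n c_gt0 n1_gt0 n_le n1_le le_x le_tot.
have n_gt0 : 0 < n by rewrite addn_gt0 n1_gt0.
have le_u : trunc_log 2 n <= trunc_log 2 n1 + 2.
  have n1_4 : n <= 2 * (2 * n1) by lia.
  apply: leq_trans (leq_trunc_log 2 n1_4) _.
  by rewrite mul2n trunc_log2_double ?mul2n ?trunc_log2_double ?double_gt0 // addn2.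
move: (trunc_log 2 n) (trunc_log 2 n1) le_x le_tot le_u => u u1 le_x le_tot le_u.
have : 3 * x <= 2 * tot + 3 * (Dl + 2 * (c * Dl * u.+1)).
  rewrite -(leq_pmul2l n_gt0); nia.
nia.
Qed.

(** * Recursive placement and routing *)

Section Route.
Variables (V E : finType) (s t : E -> V) (Dl c : nat).
Hypothesis degree_le : forall v, #|incident s t [set v]| <= Dl.
Hypothesis c_gt0 : 0 < c.
Hypothesis cutwidth_log : forall S,
  cutwidth_le s t S (c * Dl * (trunc_log 2 #|S|).+1).
Variables (D : finType) (i0 i1 : D) (r : nat).
Hypothesis i01 : i1 != i0.
Hypothesis r_ge3 : 3 <= r.

Local Notation cut := (cut s t).
Local Notation inner := (inner s t).
Local Notation point := (point D).
Local Notation load := (port_load Dl c #|D| r).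
Local Notation weight := (load_weight (4 * #|D|) r.+1).
Local Notation class := (level_class (4 * #|D|) r.+1).

Definition cut_end (S : {set V}) (e : E) : V := if s e \in S then s e else t e.

(* The edges that cross [S] leave the box at the ports prescribed by [q]. *)
Definition routes_in (a b : D -> nat) (S : {set V}) (q : E -> point)
    (pi : V -> point) (R : E -> D -> point -> bool) : Prop :=
  [/\ {in S &, injective pi} /\ (forall v, v \in S -> in_box a b (pi v)),
      forall e i x, R e i x -> in_box a b x && in_box a b (succ_coord i x),
      forall e, e \in inner S -> joined (R e) (pi (s e)) (pi (t e)),
      forall e, e \in cut S -> joined (R e) (pi (cut_end S e)) (q e) &
      forall i x, #|[set e | R e i x]| <=
        2 * load * weight (volume b) (x (if i == i0 then i1 else i0)) +
        (i != i0) * #|[set e in cut S | q e i0 == x i0]|].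

Lemma routes_unit (a b : D -> nat) (S : {set V}) (q : E -> point) :
    #|S| = volume b -> volume b = 1 -> (forall k, 0 < b k) ->
    (forall e, e \in cut S -> in_box a b (q e)) ->
  exists pi R, routes_in a b S q pi R.
Proof.
move=> cardS vol1 b_gt0 qB; have b1 k : b k = 1.
  by apply/eqP; rewrite eqn_leq b_gt0 andbT -vol1 side_le_volume.
rewrite vol1 in cardS; have /eqP/cards1P[v0 S1] := cardS.
pose x0 : point := [ffun k => a k].
have only_x0 x : in_box a b x -> x = x0.
  by move=> /forallP xB; apply/ffunP=> k; rewrite ffunE; have := xB k; rewrite b1; lia.
exists (fun=> x0), (fun _ _ _ => false); split=> //.
- split=> [u v|v _]; first by rewrite S1 !inE => /eqP-> /eqP->.
  by apply/forallP=> k; rewrite ffunE b1; lia.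
- by move=> e _; apply: joined_refl.
- by move=> e /qB/only_x0->; apply: joined_refl.
move=> i x; rewrite (_ : [set e | _] = set0) ?cards0 //.
Qed.

(** * Merging the routes of two half boxes *)

Section Merge.
Variables (a b : D -> nat) (S : {set V}) (q : E -> point).
Variables (a' b' : bool -> D -> nat) (S' : bool -> {set V}) (p : bool -> E -> point).
Variables (pi' : bool -> V -> point) (R' : bool -> E -> D -> point -> bool).
Hypothesis S_split : forall v, (v \in S) = (v \in S' true) || (v \in S' false).
Hypothesis S_disj : forall v, v \in S' true -> v \in S' false -> False.
Hypothesis box_sub : forall h x, in_box (a' h) (b' h) x -> in_box a b x.
Hypothesis box_disj : forall x,
  in_box (a' true) (b' true) x -> in_box (a' false) (b' false) x -> False.
Hypothesis vol' : forall h, 0 < volume (b' h) /\ 3 * volume (b' h) <= 2 * volume b.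
Hypothesis qB : forall e, e \in cut S -> in_box a b (q e).
Hypothesis pB : forall h e, e \in cut (S' h) -> in_box (a' h) (b' h) (p h e).
Hypothesis p_load : forall h (i : D) x, i \in [:: i0; i1] ->
  #|[set e in cut (S' h) | p h e i == x]| <= load * coord_class (class (volume b)) x.
Hypothesis R'P : forall h, routes_in (a' h) (b' h) (S' h) (p h) (pi' h) (R' h).

(** The point where the routes coming from the halves end: the port of the box if [e] leaves [S],
    and the port of the first half if [e] joins the two parts. *)
Let target e := if e \in cut S then q e else p true e.

Let bends h e i x :=
  (e \in cut (S' h)) && bend i0 i1 a b (p h e i1) (target e i0) i x.

Let R e i x := [|| R' true e i x, R' false e i x, bends true e i x | bends false e i x].

Let pi v := if v \in S' true then pi' true v else pi' false v.

Let pi_part h v : v \in S' h -> pi v = pi' h v.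
Proof.
rewrite /pi; case: h => [->//|vS]; case: ifP => // vS'.
by case: (S_disj vS' vS).
Qed.

Let part v : v \in S -> exists h, v \in S' h.
Proof. by rewrite S_split => /orP[]; [exists true|exists false]. Qed.

Let part_notin h v : v \in S' h -> v \notin S' (~~ h).
Proof. by case: h => vS; apply/negP=> /S_disj; apply. Qed.

Let part_sub h v : v \in S' h -> v \in S.
Proof. by rewrite S_split; case: h => ->; rewrite ?orbT. Qed.

Let cut_internal e : (e \in cut (S' true)) || (e \in cut (S' false)) ->
  e \notin cut S -> e \in cut (S' true).
Proof.
rewrite !inE !S_split; have := @part_notin true (s e); have := @part_notin true (t e).
by case: (s e \in S' true) (s e \in S' false) (t e \in S' true) (t e \in S' false)
  => [] [] [] [] // ? ?; rewrite ?implybT //=; intuition.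
Qed.

Let targetB h e : e \in cut (S' h) -> in_box a b (target e).
Proof.
move=> eC; rewrite /target; case: ifP => [/qB//|/negbT eS].
apply: (@box_sub true); apply: pB; apply: cut_internal eS.
by case: h eC => ->; rewrite ?orbT.
Qed.

Let R_part h e i x : R' h e i x -> R e i x.
Proof. by rewrite /R; case: h => ->; rewrite ?orbT. Qed.

Let joined_target h e : e \in cut (S' h) ->
  joined (R e) (pi (cut_end (S' h) e)) (target e).
Proof.
move=> eC; have [_ _ _ /(_ e eC) join _] := R'P h.
have endS : cut_end (S' h) e \in S' h.
  by move: eC; rewrite /cut_end inE; case: ifP.
rewrite (pi_part endS); apply: joined_trans (p h e) _ _ _ _.
  exact: joined_mono (R_part (h := h) (e := e)) join.
apply: joined_mono (joined_bend i01 (box_sub (pB eC)) (targetB eC)) => i x bx.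
by rewrite /R /bends; case: h {endS join} eC bx => -> ->; rewrite ?orbT.
Qed.

(** In direction [i0] a bend is found on the level of its own port, in the other directions on the
    level of its target, which is a port of [q] or of the first half. The subtracted term leaves
    room for the port term in the bound of the half containing the edge. *)
Let bend_load i x :
  #|[set e | bends true e i x || bends false e i x]| <=
    2 * load * coord_class (class (volume b)) (x (if i == i0 then i1 else i0))
      - (i != i0) * load * coord_class (class (volume b)) (x i0) +
    (i != i0) * #|[set e in cut S | q e i0 == x i0]|.
Proof.
case: eqP => [->|/eqP ne] /=.
  rewrite !mul0n subn0 addn0 -mulnA mul2n -addnn.
  have mem1 : i1 \in [:: i0; i1] by rewrite !inE eqxx orbT.
  apply: leq_trans (leq_add (p_load true (x i1) mem1) (p_load false (x i1) mem1)).
  apply: leq_trans (leq_card_setU _ _); apply/subset_leq_card/subsetP=> e.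
  rewrite !inE /bends /bend eqxx => /orP[] /and4P[eC _ _ /eqP->].
    by rewrite inE in eC; rewrite eC eqxx.
  by rewrite inE in eC; rewrite eC eqxx orbT.
rewrite !mul1n mul2n -addnn mulnDl addnK.
have mem0 : i0 \in [:: i0; i1] by rewrite !inE eqxx.
apply: leq_trans (leq_add (p_load true (x i0) mem0) (leqnn _)).
apply: leq_trans (leq_card_setU _ _); apply/subset_leq_card/subsetP=> e.
rewrite inE => bx; apply/setUP.
have eC : (e \in cut (S' true)) || (e \in cut (S' false)).
  by case/orP: bx => /andP[->]; rewrite ?orbT.
have : target e i0 == x i0.
  by case/orP: bx => /and4P[_ _ _]; rewrite (negPf ne) eq_sym.
rewrite /target; case: (boolP (e \in cut S)) => [eS tx|eS tx].
  by right; rewrite inE eS.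
by left; rewrite inE (cut_internal eC eS).
Qed.

Lemma routes_merge : routes_in a b S q pi R.
Proof.
split.
- split=> [u v /part[h uS] /part[h' vS]|v /part[h vS]]; last first.
    by rewrite (pi_part vS); apply: (box_sub (h := h)); have [[_ ->]] := R'P h.
  rewrite (pi_part uS) (pi_part vS); have [[inj inB] _ _ _ _] := R'P h.
  have [[_ inB'] _ _ _ _] := R'P h'.
  case: (eqVneq h h') => [eq_h|]; first by rewrite -eq_h in vS *; apply: inj.
  by case: h h' uS vS inB inB' {inj} => [] [] // uS vS inB inB' _ eq_pi;
     have := inB u uS; have := inB' v vS; rewrite eq_pi => h1 h2; exfalso;
     [exact: box_disj h2 h1|exact: box_disj h1 h2].
- move=> e i x; rewrite /R.
  have sub h : R' h e i x -> in_box a b x && in_box a b (succ_coord i x).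
    by have [_ inB _ _ _] := R'P h => /inB/andP[/box_sub-> /box_sub->].
  have bsub h : bends h e i x -> in_box a b x && in_box a b (succ_coord i x).
    by case/and4P=> _ -> ->.
  by case/or4P=> [/sub|/sub|/bsub|/bsub].
- move=> e; rewrite inE => /andP[/part[h sS] /part[h' tS]].
  case: (eqVneq h h') => [eq_h|ne].
    rewrite -eq_h in tS; have [_ _ join _ _] := R'P h.
    rewrite (pi_part sS) (pi_part tS); apply: joined_mono (R_part (h := h) (e := e)) _.
    by apply: join; rewrite inE sS.
  (* The routes of an edge joining the two parts meet at its target. *)
  have eq_h : h' = ~~ h by case: h h' ne {sS tS} => [] [].
  have tN : t e \notin S' h by rewrite -[h]negbK -eq_h part_notin.
  have sN : s e \notin S' h' by rewrite eq_h part_notin.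
  have js : joined (R e) (pi (s e)) (target e).
    have := @joined_target h e; rewrite /cut_end sS; apply.
    by rewrite inE sS (negPf tN).
  apply: joined_trans js _; apply: joined_sym.
  have := @joined_target h' e; rewrite /cut_end (negPf sN); apply.
  by rewrite inE tS (negPf sN).
- move=> e eS; have endS : cut_end S e \in S.
    by move: eS; rewrite /cut_end inE; case: ifP.
  have [h eh] := part endS.
  suff [eC eqE] : e \in cut (S' h) /\ cut_end (S' h) e = cut_end S e.
    by have := joined_target eC; rewrite eqE /target eS.
  move: eS eh; rewrite /cut_end !inE; case: ifP => sS.
    by move=> /= tS ->; rewrite (negPf (contra (@part_sub h _) tS)).
  by move=> /= tS ->; rewrite (contraFF (@part_sub h _) sS).
move=> i x; set y := x _; set Q := #|_|.
pose cl := coord_class (class (volume b)) y.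
have mem0 : i0 \in [:: i0; i1] by rewrite !inE eqxx.
(* The ports of a half are bounded by [p_load], and passing to the whole box adds the term of its
   level to the weight. *)
have child h : #|[set e | R' h e i x]| + 2 * load * cl <=
    2 * load * weight (volume b) y
      + (i != i0) * load * coord_class (class (volume b)) (x i0).
  have [_ _ _ _ /(_ i x) le] := R'P h; rewrite -/y in le.
  have [v_gt0 v_le] := vol' h.
  have step := @load_weight_step (4 * #|D|) r.+1 _ _ y v_gt0 v_le.
  apply: leq_trans (leq_add le (leqnn _)) _.
  rewrite addnAC; apply: leq_add; first by rewrite -mulnDr leq_mul2l step orbT.
  by rewrite -mulnA leq_mul2l (p_load h _ mem0) orbT.
(* A lattice edge lies in at most one half, so the loads of the two halves do not add up. *)
have [h0 other] : exists h0, #|[set e | R' (~~ h0) e i x]| = 0.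
  have none h : ~~ in_box (a' h) (b' h) x -> #|[set e | R' h e i x]| = 0.
    move=> xN; apply/eqP; rewrite cards_eq0; apply/eqP/setP=> e; rewrite !inE.
    have [_ inB _ _ _] := R'P h.
    by apply/negP=> /inB/andP[xB]; rewrite xB in xN.
  case: (boolP (in_box (a' true) (b' true) x)) => xB.
    by exists true; apply: none; apply/negP; apply: box_disj xB.
  by exists false; apply: none.
have le_R : #|[set e | R e i x]| <= #|[set e | R' h0 e i x]| +
    #|[set e | R' (~~ h0) e i x]| + #|[set e | bends true e i x || bends false e i x]|.
  apply: leq_trans (leq_add (leq_card_setU _ _) (leqnn _)).
  apply: leq_trans (leq_card_setU _ _); apply/subset_leq_card/subsetP=> e.
  rewrite !inE /R; case: (h0) => /=; case: (R' true e i x) => //=;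
    by case: (R' false e i x).
apply: leq_trans le_R _; rewrite other addn0.
have := child h0; have := bend_load i x; rewrite -/Q -/y -/cl.
(* For [i != i0] the coordinate [y] is [x i0], so the truncated subtraction in [bend_load] is
   exact. *)
have : (i != i0) * load * coord_class (class (volume b)) (x i0) <= 2 * load * cl.
  rewrite /cl /y; case: eqP => _; first by rewrite !mul0n.
  by rewrite leq_mul2r leq_mul2r ?orbT.
lia.
Qed.
End Merge.

(** Only coordinates [i0] and [i1] receive labels, chosen independently; the others stay at the
    lower corner. Edges may share a port. *)
Lemma ports_exist (n : nat) (a b : D -> nat) (S : {set V}) :
    (forall k, 0 < b k) -> volume b <= n -> (forall k, n <= (r * b k) ^ #|D|) ->
    #|cut S| <= Dl * (c * (45 + 6 * trunc_log 2 (volume b))) ->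
  exists p : E -> point, (forall e, e \in cut S -> in_box a b (p e)) /\
    forall i x, i \in [:: i0; i1] ->
      #|[set e in cut S | p e i == x]| <= load * coord_class (class n) x.
Proof.
move=> b_gt0 le_n le_b leS; have D_gt0 : 0 < #|D| by apply/card_gt0P; exists i0.
have labels k := port_labels (a k) D_gt0 (b_gt0 k) (volume_gt0 b_gt0) le_n (le_b k) leS.
have [f0 [f0B f0L]] := labels i0; have [f1 [f1B f1L]] := labels i1.
exists (fun e => [ffun k => if k == i0 then f0 e else if k == i1 then f1 e else a k]).
split=> [e eS|i x].
  apply/forallP=> k; rewrite ffunE; case: eqP => [->|_]; first exact: f0B.
  case: eqP => [->|_]; first exact: f1B.
  by have := b_gt0 k; lia.
rewrite !inE => /orP[] /eqP->.
  apply: leq_trans (f0L x); apply/subset_leq_card/subsetP=> e.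
  by rewrite !inE ffunE eqxx.
apply: leq_trans (f1L x); apply/subset_leq_card/subsetP=> e.
by rewrite !inE ffunE (negPf i01) eqxx.
Qed.

(** Induction on the volume: halve a longest side, split [S] accordingly, choose ports for both
    halves and merge their routes. *)
Lemma routes_exist (a b : D -> nat) (S : {set V}) (q : E -> point) :
    (forall k, 0 < b k) -> (forall k l, b k <= r * b l) -> #|S| = volume b ->
    #|cut S| <= Dl * (c * (45 + 6 * trunc_log 2 (volume b))) ->
    (forall e, e \in cut S -> in_box a b (q e)) ->
  exists pi R, routes_in a b S q pi R.
Proof.
have [m] := ubnP (volume b); elim: m a b S q => // m IH a b S q /ltnSE le_m.
move=> b_gt0 b_shape cardS leS qB.
have [i _ b_max] := @arg_maxnP D i0 predT b isT.
have [le1|gt1] := leqP (b i) 1.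
  apply: routes_unit => //; apply/eqP; rewrite eqn_leq volume_gt0 // andbT.
  apply: leq_trans (volume_le_exp (m := 1) _) _ => [k|]; last by rewrite exp1n.
  exact: leq_trans (b_max k isT) le1.
set h := (b i)./2.
(* Both parts of a side of length at least 2 have between a third and two thirds of its length. *)
have hE : (h <= b i - h) && (b i <= 3 * h) && (3 * (b i - h) <= 2 * b i) && (0 < h).
  by rewrite /h; lia.
case/andP: hE => /andP[/andP[h_le h3] h2] h_gt0.
have vB (e : bool) : (if e then h else b i - h) <= b i <= 3 * (if e then h else b i - h).
  by case: e; lia.
pose b' (e : bool) := upd b i (if e then h else b i - h).
pose a' (e : bool) := if e then a else upd a i (a i + h).
have bi_gt0 := b_gt0 i.
have volE e : b i * volume (b' e) = (if e then h else b i - h) * volume b.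
  exact: volume_upd.
have b'_gt0 e k : 0 < b' e k.
  by rewrite /b' /upd; case: eqP => [_|_]; [case: e; lia|].
have vol'_gt0 e : 0 < volume (b' e) by apply: volume_gt0.
(* Only a longest side shrinks, and by a factor of at most 3, so [3 <= r] preserves the bound on
   side ratios. *)
have b'_shape e k l : b' e k <= r * b' e l.
  have /andP[v_le v_ge] := vB e; have bk := b_max k isT.
  rewrite /b' /upd; move: (if e then _ else _) v_le v_ge => v v_le v_ge.
  case: eqP => _; case: eqP => _ //.
  - by rewrite leq_pmull //; lia.
  - exact: leq_trans v_le (b_shape i l).
  - by apply: leq_trans bk (leq_trans v_ge _); rewrite leq_mul2r r_ge3 orbT.
have volD : volume (b' true) + volume (b' false) = volume b.
  apply/eqP; rewrite -(eqn_pmul2l bi_gt0) mulnDr !volE -mulnDl subnKC //.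
  by apply: leq_trans h_le (leq_subr _ _).
have vol_le e : 3 * volume (b' e) <= 2 * volume b.
  rewrite -(leq_pmul2l bi_gt0) !(mulnCA (b i)) volE !mulnA leq_mul2r.
  by apply/orP; right; case: e; lia.
have vol_ge e : volume b <= 3 * volume (b' e).
  rewrite -(leq_pmul2l bi_gt0) !(mulnCA (b i)) volE !mulnA leq_mul2r.
  by apply/orP; right; case: e; lia.
have room e k : volume b <= (r * b' e k) ^ #|D|.
  apply: volume_le_exp => l; have /andP[_ v_ge] := vB e; have bl := b_max l isT.
  rewrite /b' /upd; case: eqP => _; last exact: b_shape.
  by apply: leq_trans bl (leq_trans v_ge _); rewrite leq_mul2r r_ge3 orbT.
have cardS' : #|S| = volume (b' true) + volume (b' false) by rewrite volD.
have [A [AS cardA cutA cutA']] :=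
  balanced_split degree_le cardS' (vol'_gt0 true) (cutwidth_log S).
pose S' (e : bool) := if e then A else S :\: A.
have S'card e : #|S' e| = volume (b' e).
  case: e => //=; have := cardsID A S; rewrite (setIidPr AS) cardA cardS'.
  by move/addnI.
have S'cut e : #|cut (S' e)| <= Dl * (c * (45 + 6 * trunc_log 2 (volume (b' e)))).
  rewrite cardS' in cutA cutA'; rewrite -volD in leS.
  have ge := vol_ge e; have le := vol_le e; rewrite -volD in ge le.
  case: e ge le => ge le; first exact: boundary_step cutA leS.
  (* Exchanging the summands makes the second half play the role of [n1]. *)
  rewrite addnC in ge le cutA' leS; exact: boundary_step cutA' leS.
have vol_lt e : volume (b' e) < volume b.
  by have := vol_le e; have := volume_gt0 b_gt0; lia.
have ports e := ports_exist (a' e) (b'_gt0 e) (ltnW (vol_lt e)) (room e) (S'cut e).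
have [p1 [p1B p1L]] := ports true.
have [p2 [p2B p2L]] := ports false.
pose p (e : bool) := if e then p1 else p2.
have pB e f : f \in cut (S' e) -> in_box (a' e) (b' e) (p e f).
  by case: e; [apply: p1B|apply: p2B].
have lt_m e : volume (b' e) < m by apply: leq_trans (vol_lt e) le_m.
have sub e := IH (a' e) (b' e) (S' e) (p e) (lt_m e) (b'_gt0 e) (b'_shape e)
  (S'card e) (S'cut e) (pB e).
have [pi1 [R1 R1P]] := sub true; have [pi2 [R2 R2P]] := sub false.
pose pi (e : bool) := if e then pi1 else pi2.
pose R (e : bool) := if e then R1 else R2.
have RP e : routes_in (a' e) (b' e) (S' e) (p e) (pi e) (R e) by case: e.
have := routes_merge (a := a) (b := b) (S := S) (q := q) _ _ _ _ _ _ pB _ RP.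
move=> merge; eexists; eexists; apply: merge => //.
- by move=> v; rewrite /= inE; case: (boolP (v \in A)) => [/(subsetP AS)->|].
- by move=> v /= vA; rewrite inE vA.
- move=> e x /forallP xB; apply/forallP=> k; move: (xB k) => {xB}.
  by rewrite /a' /b' /upd; case: e => /=; case: eqP => [->|_]; lia.
- move=> x /forallP/(_ i) x1 /forallP/(_ i); move: x1.
  by rewrite /a' /b' /upd /= eqxx; lia.
by case; [apply: p1L|apply: p2L].
Qed.
End Route.

(** * Embeddings into the grid *)

Section Walk.
Variable V : finType.

Lemma walk_edges_cons (x a : V) p :
  walk_edges x (a :: p) = [set x; a] |: walk_edges a p.
Proof.
apply/setP=> e; rewrite in_setU1 /walk_edges; apply/imsetP/orP=> [[q]|].
  rewrite /= inE => /orP[/eqP->|qp] ->; [by left|right].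
  by apply/imsetP; exists q.
case=> [/eqP->|/imsetP[q qp ->]].
  by exists (x, a) => //=; rewrite inE eqxx.
by exists q => //=; rewrite inE; apply/orP; right.
Qed.

Lemma walk_edges_rcons (x z : V) p :
  walk_edges x (rcons p z) = [set last x p; z] |: walk_edges x p.
Proof.
by elim: p x => [|a p IH] x; rewrite /= !walk_edges_cons // IH setUCA.
Qed.

Lemma walk_edges_rev (x : V) p :
  walk_edges (last x p) (rev (belast x p)) = walk_edges x p.
Proof.
elim: p x => [|a p IH] x //=.
rewrite rev_cons walk_edges_rcons walk_edges_cons IH.
have -> : last (last a p) (rev (belast a p)) = a.
  by case: p {IH} => //= b p; rewrite rev_cons last_rcons.
by rewrite [[set a; x]]setUC.
Qed.

Lemma walk_edgesP (e : rel V) x p (s : {set V}) : path e x p ->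
  s \in walk_edges x p -> exists a b, s = [set a; b] /\ e a b.
Proof.
elim: p x => [|a p IH] x /=; first by move=> _ /imsetP[].
move=> /andP[xa ap]; rewrite walk_edges_cons in_setU1 => /orP[/eqP->|].
  by exists x, a.
exact: IH.
Qed.
End Walk.

Lemma is_path_rev (H : sgraph) (x y : H) p : is_path x p y ->
  exists2 p', is_path y p' x & walk_edges y p' = walk_edges x p.
Proof.
move=> [xp <- Up]; exists (rev (belast x p)); last exact: walk_edges_rev.
split.
- by rewrite rev_path; apply: sub_path xp => a b; rewrite adj_sym.
- by case: p {xp Up} => //= a p; rewrite rev_cons last_rcons.
by rewrite -rev_rcons -lastI rev_uniq.
Qed.

(** A simple path is extracted from each connected route. [E] may represent an edge of [G] several
    times, and [rho] picks one representative, possibly of the opposite orientation; its path is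
    then reversed. *)
Lemma embedding_of_routes (G H : sgraph) (E : finType) (s t : E -> G)
    (f : G -> H) (Q : E -> rel H) (K : nat) :
    injective f -> (forall u v, adj u v -> exists e, s e = u /\ t e = v) ->
    (forall e, subrel (Q e) adj) -> (forall e, symmetric (Q e)) ->
    (forall e, connect (Q e) (f (s e)) (f (t e))) ->
    (forall x y, adj x y -> #|[set e | Q e x y]| <= K) ->
  exists F : embedding G H, edge_congestion F <= K.
Proof.
move=> f_inj stP Qadj Qsym Qconn Qload.
have /fin_all_exists[P PP] (e : E) : exists p,
    [/\ path (Q e) (f (s e)) p, last (f (s e)) p = f (t e) & uniq (f (s e) :: p)].
  have /connectP[p fp last_p] := Qconn e.
  by case: (shortenP fp) last_p => p' fp' Up' _ ->; exists p'.
have P_path e : is_path (f (s e)) (P e) (f (t e)).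
  by have [Pe last_e U] := PP e; split=> //; apply: sub_path Pe; apply: Qadj.
pose rho (X : {set G}) : {set {set H}} :=
  if [pick e | X == [set s e; t e]] is Some e
  then walk_edges (f (s e)) (P e) else set0.
have rhoP u v : adj u v -> exists2 p : seq H,
    is_path (f u) p (f v) & rho [set u; v] = walk_edges (f u) p.
  move=> uv; rewrite /rho; case: pickP => [e /eqP eq_uv|none]; last first.
    by have [e [se te]] := stP u v uv; have := none e; rewrite se te eqxx.
  have uNv : u != v by apply: contraTneq uv => ->; rewrite adj_irrefl.
  have := P_path e; have := set21 u v; have := set22 u v.
  rewrite eq_uv !inE => /orP[] /eqP v_e /orP[] /eqP u_e; try by rewrite v_e u_e eqxx in uNv.
    by rewrite -v_e -u_e => /is_path_rev[p fp eq_p]; exists p.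
  by rewrite -v_e -u_e => fp; exists (P e).
exists (Embedding f_inj rhoP); apply/bigmax_leqP=> e'.
rewrite inE => /existsP[x /existsP[y /andP[xy /eqP->]]].
apply: leq_trans (Qload x y xy).
apply: leq_trans (leq_imset_card (fun e => [set s e; t e]) _).
apply/subset_leq_card/subsetP=> X; rewrite !inE /= => /andP[_].
rewrite /rho; case: pickP => [e /eqP-> xyP|_]; last by rewrite inE.
apply/imsetP; exists e => //; rewrite inE; have [Pe _ _] := PP e.
have [a [b [eq_ab ab]]] := walk_edgesP Pe xyP.
have xNy : x != y by apply: contraTneq xy => ->; rewrite adj_irrefl.
have := set21 x y; have := set22 x y.
rewrite eq_ab !inE => /orP[] /eqP y_ab /orP[] /eqP x_ab.
- by rewrite x_ab y_ab eqxx in xNy.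
- by rewrite x_ab y_ab Qsym.
- by rewrite x_ab y_ab.
- by rewrite x_ab y_ab eqxx in xNy.
Qed.

Lemma card_grid (d : nat) (l : 'I_d -> nat) : #|grid l| = volume l.
Proof.
rewrite card_dep_ffun foldrE big_image /=; apply: eq_bigr => i _.
exact: card_ord.
Qed.

(** * Grid nodes as lattice points *)

Section GridPoints.
Variables (d : nat) (l : 'I_d -> nat).
Hypothesis l_gt0 : forall i, 0 < l i.

(** Coordinates out of range default to 0; points of the box are unaffected. *)
Definition node_of_point (x : point 'I_d) : grid l :=
  [ffun i => insubd (Ordinal (l_gt0 i)) (x i)].

Definition point_of_node (z : grid l) : point 'I_d := [ffun i => val (z i)].

Lemma node_of_pointK x : in_box (fun=> 0) l x -> point_of_node (node_of_point x) = x.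
Proof.
move=> /forallP xB; apply/ffunP=> i; rewrite !ffunE val_insubd.
by have /= := xB i; rewrite add0n => ->.
Qed.

Lemma grid_adjP (z w : grid l) : adj z w ->
  (exists i, point_of_node w = succ_coord i (point_of_node z)) \/
  (exists i, point_of_node z = succ_coord i (point_of_node w)).
Proof.
suff succE (x y : grid l) i : (x i).+1 == y i :> nat ->
    [forall j, (j != i) ==> (x j == y j)] ->
    point_of_node y = succ_coord i (point_of_node x).
  case/existsP=> i /andP[/orP[] zi eq_zw]; [left|right]; exists i; apply: succE => //.
  by apply/forallP=> j; have := forallP eq_zw j; rewrite (eq_sym (z j)).
move=> /eqP xi /forallP eq_xy; apply/ffunP=> j; rewrite !ffunE.
case: (eqVneq j i) => [->|ji]; first by rewrite xi.
by have := eq_xy j; rewrite ji => /eqP->.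
Qed.

Lemma succ_grid_adj (z w : grid l) i :
  point_of_node w = succ_coord i (point_of_node z) -> adj z w.
Proof.
move=> /ffunP eq_w; apply/existsP; exists i; apply/andP; split.
  by have := eq_w i; rewrite !ffunE eqxx => ->; rewrite eqxx.
apply/forallP=> j; apply/implyP=> ji; apply/eqP/val_inj.
by have := eq_w j; rewrite !ffunE (negPf ji) => ->.
Qed.

Definition route_rel (P : 'I_d -> point 'I_d -> bool) : rel (grid l) :=
  fun z w => [exists i,
    (P i (point_of_node z) && (point_of_node w == succ_coord i (point_of_node z))) ||
    (P i (point_of_node w) && (point_of_node z == succ_coord i (point_of_node w)))].

Lemma route_rel_sym P : symmetric (route_rel P).
Proof. by move=> z w; apply: eq_existsb => i; rewrite orbC. Qed.

Lemma route_rel_adj P : subrel (route_rel P) adj.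
Proof.
move=> z w /existsP[i /orP[]] /andP[_ /eqP]; first exact: succ_grid_adj.
by rewrite adj_sym; apply: succ_grid_adj.
Qed.

Lemma joined_connect (P : 'I_d -> point 'I_d -> bool) x y :
  (forall i z, P i z -> in_box (fun=> 0) l z && in_box (fun=> 0) l (succ_coord i z)) ->
  joined P x y -> connect (route_rel P) (node_of_point x) (node_of_point y).
Proof.
move=> inB; elim=> {x y} [x|i x Px|x y _|y x z _ IHx _].
- exact: connect0.
- apply/connect1/existsP; exists i; have /andP[xB yB] := inB _ _ Px.
  by rewrite !node_of_pointK // Px eqxx.
- by rewrite (sym_connect_sym (@route_rel_sym P)).
exact: connect_trans.
Qed.

(** The two ends of a grid edge determine its direction and its lower end, which excludes every
    other disjunct of [route_rel]. *)
Lemma route_rel_succ P z w i : point_of_node w = succ_coord i (point_of_node z) ->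
  route_rel P z w -> P i (point_of_node z).
Proof.
move=> /ffunP eq_w /existsP[j /orP[]] /andP[Pj /eqP/ffunP eq_j].
  suff -> : i = j by [].
  apply/eqP; apply: contraT => ij; have := eq_w j.
  by rewrite eq_j /succ_coord set_coordE set_coord_neq 1?eq_sym // => /esym/n_Sn[].
have := eq_j i; have := eq_w i; rewrite /succ_coord set_coordE => wi.
by rewrite [RHS]ffunE; case: eqP => [<-|_]; rewrite wi;
   move: (point_of_node z i) => n /eqP; rewrite ltn_eqF.
Qed.
End GridPoints.

Lemma grid_embedding (t d r : nat) (hd : 2 <= d) (G : sgraph) (l : 'I_d -> nat) :
    2 < r -> treewidth_at_most G t -> (forall i, 0 < l i) ->
    #|G| <= #|grid l| -> (forall i j, l i <= r * l j) ->
  exists F : embedding G (grid l), edge_congestion F <=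
    2 * port_load (2 * max_degree G) t.+1 d r * (4 * d * r.+3).
Proof.
move=> r_gt2 [T [bag [Tdec bag_t]]] l_gt0 G_le l_r.
(* Each edge of [G] occurs in both orientations, which doubles the degree bound. *)
pose E := {x : G * G | adj x.1 x.2} : finType.
pose s (e : E) := (val e).1; pose u (e : E) := (val e).2.
(* Isolated nodes pad [G] so that the node set fills the grid exactly, as the recursion requires. *)
pose V := (G + 'I_(#|grid l| - #|G|))%type : finType.
pose s' (e : E) : V := inl (s e); pose u' (e : E) : V := inl (u e).
have cardV : #|[set: V]| = volume l.
  by rewrite cardsT card_sum card_ord subnKC // card_grid.
have deg v : #|incident s' u' [set v]| <= 2 * max_degree G.
  have le_deg g (h k : E -> G) : injective (fun e => (h e, k e)) ->
      (forall e, adj (h e) (k e)) -> #|[set e | h e == g]| <= max_degree G.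
    move=> hk_inj hk; apply: leq_trans (leq_bigmax g).
    rewrite -(card_in_imset (f := k)) => [|e e']; last first.
      by rewrite !inE => /eqP he /eqP he' eq_k; apply: hk_inj; rewrite he he' eq_k.
    apply/subset_leq_card/subsetP=> w /imsetP[e]; rewrite !inE => /eqP <- ->.
    exact: hk.
  case: v => [g|i]; last first.
    by rewrite (_ : incident _ _ _ = set0) ?cards0 //; apply/setP=> e; rewrite !inE.
  rewrite mul2n -addnn.
  apply: leq_trans (leq_add (le_deg g s u _ _) (le_deg g u s _ _)).
  - apply: leq_trans (leq_card_setU _ _); apply/subset_leq_card/subsetP=> e.
    by rewrite !inE.
  - by move=> [[a b] ab] [[a' b'] ab'] [/= eqa eqb]; apply: val_inj; congr (_, _).
  - by move=> e; apply: (valP e).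
  - by move=> [[a b] ab] [[a' b'] ab'] [/= eqb eqa]; apply: val_inj; congr (_, _).
  by move=> e; rewrite adj_sym; apply: (valP e).
have sep : has_separators s' u' t.+1.
  apply: (treewidth_separators Tdec) => [x|e]; last exact: (valP e).
  have : #|bag x| <= \max_(x : T) #|bag x| by apply: (leq_bigmax x).
  by move: bag_t; rewrite /width; lia.
pose i0 : 'I_d := Ordinal (ltnW hd); pose i1 : 'I_d := Ordinal hd.
have cut0 : cut s' u' [set: V] = set0 by apply/setP=> e; rewrite !inE.
(* No edge leaves the whole node set, so the ports [q] are arbitrary. *)
have [||pi [R [[pi_inj piB] RB Rinner _ Rload]]] :=
  @routes_exist V E s' u' _ t.+1 deg isT (fun S => cutwidth_log deg S sep)
    'I_d i0 i1 r isT r_gt2 (fun=> 0) l [set: V] (fun=> [ffun=> 0]) l_gt0 l_r cardV.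
- by rewrite cut0 cards0.
- by move=> e; rewrite cut0 inE.
pose f (v : G) := node_of_point l_gt0 (pi (inl v)).
apply: (@embedding_of_routes G (grid l) E s u f (fun e => route_rel (R e))).
- move=> v w /(congr1 (@point_of_node d l)); rewrite !node_of_pointK ?piB ?inE //.
  by move=> /pi_inj; rewrite !inE => /(_ isT isT)[].
- by move=> v w vw; exists (Sub (v, w) vw); rewrite /s /u SubK.
- by move=> e; apply: route_rel_adj.
- by move=> e; apply: route_rel_sym.
- by move=> e; apply: joined_connect (RB e) _; apply: Rinner; rewrite !inE.
have main x y i : point_of_node y = succ_coord i (point_of_node x) ->
  #|[set e | route_rel (R e) x y]| <=
    2 * port_load (2 * max_degree G) t.+1 d r * (4 * d * r.+3).
  move=> xy; have := Rload i (point_of_node x); rewrite cut0.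
  rewrite [X in _ + _ * X](_ : _ = 0) ?muln0 ?addn0; last first.
    by apply/eqP; rewrite cards_eq0; apply/eqP/setP=> e; rewrite !inE.
  move=> le; apply: (leq_trans _ (leq_trans le _)).
    by apply/subset_leq_card/subsetP=> e; rewrite !inE; apply: route_rel_succ xy.
  by rewrite card_ord leq_mul2l load_weight_le ?orbT // muln_gt0 /=; lia.
move=> x y /grid_adjP[] [i xy]; first exact: main xy.
rewrite (_ : [set e | _] = [set e | route_rel (R e) y x]); first exact: main xy.
by apply/setP=> e; rewrite !inE route_rel_sym.
Qed.

(** * From the aspect ratio to ratios of sides *)

Section AspectRatio.
Import Order.TTheory GRing.Theory Num.Theory.
Local Open Scope ring_scope.

Lemma sides_of_aspect_ratio (R : realType) (d : nat) (l : 'I_d -> nat) (mu : R) :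
    (forall i, 0 < l i)%N -> aspect_ratio R l <= mu ->
  forall i j, (l i <= (Num.truncn mu).+1 * l j)%N.
Proof.
move=> l_gt0 ratio i j; have : (l i)%:R / (l j)%:R <= mu.
  apply: le_trans ratio; apply: le_trans (le_bigmax _ _ j).
  exact: (le_bigmax _ (fun k => (l k)%:R / (l j)%:R) i).
rewrite ler_pdivrMr ?ltr0n // => le_mu; rewrite -(ler_nat R) natrM.
apply: le_trans le_mu _; rewrite ler_wpM2r ?ler0n // ltW //.
by rewrite truncnS_gt.
Qed.
End AspectRatio.

Theorem corollary2 (R : realType) (t d : nat) (mu : R) (hd : 2 <= d)
    (hmu : (1 <= mu)%R) :
  exists C : nat,
    forall (G : sgraph) (N Delta : nat) (l : 'I_d -> nat),
      #|G| = N ->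
      max_degree G = Delta ->
      treewidth_at_most G t ->
      (forall i : 'I_d, 0 < l i) ->
      N <= #|grid l| ->
      (aspect_ratio R l <= mu)%R ->
      exists E : embedding G (grid l), edge_congestion E <= C * Delta.
Proof.
(* The recursion needs a ratio of at least 3; the successor of the truncation exceeds [mu]. *)
pose r := maxn 3 (Num.truncn mu).+1.
(* This is the bound of [grid_embedding] with the factor [max_degree G] taken out. *)
exists (2 * (2 * (t.+1 * (45 + 24 * d)) * 2 ^ r.+1) * (4 * d * r.+3)).
move=> G N Delta l <- <- tw l_gt0 le_N ratio.
have l_r i j : l i <= r * l j.
  apply: leq_trans (sides_of_aspect_ratio l_gt0 ratio i j) _.
  by rewrite leq_mul2r leq_maxr orbT.
have [F leF] := grid_embedding hd (leq_maxl _ _ : 2 < r) tw l_gt0 le_N l_r.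
exists F; apply: leq_trans leF _.
rewrite leq_eqVlt; apply/orP; left; apply/eqP.
rewrite /port_load; lia.
Qed.
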